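(* Let $\mathbb D\subset\mathbb C$ be contractible, let $f:\mathbb D\to SO^+(1,n+3)/SO^+(1,3)\times SO(n)$ be a conformally harmonic map, and let $\gamma$ be a conformal automorphism of $\mathbb D$ inducing the symmetry $\gamma^*f=\chi(\lambda)f$ of $f$. If $f$ induces a unique Willmore surface $y=[Y]$ into $S^{n+2}$ (i.e. $y$ is either not S-Willmore or the dual surface of $y$ reduces to a point), then this symmetry of $f$ induces the symmetry $$\gamma^*y=[\gamma^*Y]=[\chi(\lambda)Y].$$ If $f$ induces a pair of dual Willmore surfaces $y=[Y]$ and $\hat y=[\hat Y]$ into $S^{n+2}$, then this symmetry of $f$ induces the symmetry $$\gamma^*y=[\gamma^*Y]=[\chi(\lambda)Y]\qquad\text{or}\qquad\gamma^*\hat y=[\gamma^*\hat Y]=[\chi(\lambda)Y].$$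
   Context: Fix $n\ge1$. $\mathbb{R}^{n+4}_1$ is $\mathbb{R}^{n+4}$ with form $-x_0^2+x_1^2+\dots+x_{n+3}^2$; $O^+(1,n+3)$ is the group of its linear isometries preserving the forward light cone, acting on $S^{n+2}$ (identified with the projectivized light cone) by $[Y]\mapsto[RY]$. $G=SO^+(1,n+3)$ is the identity component, $K=SO^+(1,3)\times SO(n)$, $\sigma=\mathrm{Ad}\,\mathrm{diag}(-I_4,I_n)$, $\mathfrak g=\mathfrak k\oplus\mathfrak p$ the eigenspace decomposition of $\sigma$, $\tilde P=\mathrm{diag}(1,1,1,1,-1,1,\dots,1)$. $A\in O^+(1,n+3)$ acts on $G/K$ by $gK\mapsto AgK$ if $\det A=1$ and $gK\mapsto Ag\tilde PK$ if $\det A=-1$. Points $gK$ of $G/K$ represent the (oriented) Lorentzian 4-spaces $g\,\mathrm{Span}(e_0,\dots,e_3)$. Here $f$ stands for the members $f_\lambda=F(\cdot,\lambda)\bmod K$, $\lambda\in S^1$, of its associated family, and correspondingly $y,\hat y,Y,\hat Y$ depend on $\lambda$; $F(\cdot,\lambda)$ is the extended frame: for a lift $F$ of $f$ with $\alpha=F^{-1}dF=\alpha_{\mathfrak k}+\alpha'_{\mathfrak p}+\alpha''_{\mathfrak p}$ ($(1,0)$- and $(0,1)$-parts of the $\mathfrak p$-part), it solves $dF=F(\lambda^{-1}\alpha'_{\mathfrak p}+\alpha_{\mathfrak k}+\lambda\alpha''_{\mathfrak p})$ with $F(0,\lambda)=I$ (base point $0\in\mathbb D$). The monodromy $\chi(\lambda)$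 satisfies $\chi\in(\Lambda SO^+(1,n+3)_\sigma)^0$ or $\chi\tilde P\in(\Lambda SO^+(1,n+3)_\sigma)^0$, where $\Lambda SO^+(1,n+3)_\sigma$ is the group of loops $g:S^1\to SO^+(1,n+3)$ with $\sigma(g(\lambda))=g(-\lambda)$ and $(\cdot)^0$ denotes the identity component. For a conformal immersion $y=[Y]$ into $S^{n+2}$, with $Y$ the forward light cone lift with $\langle Y_z,Y_{\bar z}\rangle=\frac12$, the conformal Gauss map is $p\mapsto\mathrm{Span}_{\mathbb R}\{Y,\mathrm{Re}\,Y_z,\mathrm{Im}\,Y_z,Y_{z\bar z}\}$, viewed as a map into $G/K$; $y$ is Willmore iff it is harmonic. ''$f$ induces $y$'' means that $f$ is the conformal Gauss map of $y$. $y$ is S-Willmore if it admits a dual (Willmore) surface $\hat y$, i.e. one having the same conformal Gauss map as $y$. *)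

(* Defs.v *)
From HB Require Import structures.
From mathcomp Require Import all_boot all_order all_algebra.
From mathcomp Require Import all_classical all_reals all_analysis.
From mathcomp Require Import complex.

Set Implicit Arguments.
Unset Strict Implicit.
Unset Printing Implicit Defensive.

Import Order.TTheory GRing.Theory Num.Theory.
Import numFieldNormedType.Exports.

Local Open Scope classical_set_scope.
Local Open Scope ring_scope.
Local Open Scope complex_scope.

(* The parameter z = x + iy of the domain and the loop parameter lambda are
   both points of R * R, standing for the complex plane. *)
Definition toC (R : realType) (z : R * R) : R[i] := z.1 +i* z.2.

Definition circle (R : realType) : set (R * R) := [set z | `|toC z| = 1].

(** * Calculus on the plane *)

Section Calculus.
Variables (R : realType) (V : normedModType R).

Definition dx (f : R * R -> V) (z : R * R) : V := 'D_((1, 0) : R * R) f z.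
Definition dy (f : R * R -> V) (z : R * R) : V := 'D_((0, 1) : R * R) f z.

(* Meant for open D. *)
Fixpoint Ck_on (k : nat) (D : set (R * R)) (f : R * R -> V) : Prop :=
  match k with
  | 0 => forall z, D z -> {for z, continuous f}
  | k'.+1 => [/\ forall z, D z -> differentiable f z,
                 Ck_on k' D (dx f) & Ck_on k' D (dy f)]
  end.

Definition smooth_on (D : set (R * R)) (f : R * R -> V) : Prop :=
  forall k, Ck_on k D f.

(* The Wirtinger derivatives: f_z = (f_x - i f_y) / 2, and the Laplacian is
   four times the mixed derivative. *)
Definition Re_dz (f : R * R -> V) (z : R * R) : V := 2^-1 *: dx f z.
Definition Im_dz (f : R * R -> V) (z : R * R) : V := - (2^-1 *: dy f z).
Definition dzdzbar (f : R * R -> V) (z : R * R) : V :=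
  4^-1 *: (dx (dx f) z + dy (dy f) z).

End Calculus.

Definition contractible (R : realType) (D : set (R * R)) : Prop :=
  exists2 z0, D z0 & exists H : R * (R * R) -> R * R,
    [/\ {within `[0, 1]%classic `*` D, continuous H},
        forall t z, `[0, 1]%classic t -> D z -> D (H (t, z)),
        forall z, D z -> H (0, z) = z
      & forall z, D z -> H (1, z) = z0].

(* Cauchy-Riemann equations. *)
Definition holomorphic_on (R : realType) (D : set (R * R))
    (g : R * R -> R * R) : Prop :=
  smooth_on D g /\
  forall z, D z -> (dx g z).1 = (dy g z).2 /\ (dy g z).1 = - (dx g z).2.

Definition conformal_automorphism (R : realType) (D : set (R * R))
    (g : R * R -> R * R) : Prop :=
  exists h : R * R -> R * R,
    [/\ holomorphic_on D g, holomorphic_on D h,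
        forall z, D z -> D (g z) /\ h (g z) = z
      & forall z, D z -> D (h z) /\ g (h z) = z].

(** * Lorentzian linear algebra *)

Section Lorentz.
Variable R : realType.

Definition minkowski m : 'M[R]_m.+1 :=
  diag_mx (\row_i (if i == ord0 then -1 else 1)).

Definition ip m (v w : 'cV[R]_m.+1) : R := (v^T *m minkowski m *m w) ord0 ord0.

Definition forward_cone m : set 'cV[R]_m.+1 :=
  [set v | ip v v = 0 /\ 0 < v ord0 ord0].

Definition Oplus m : set 'M[R]_m.+1 :=
  [set A | (forall v w : 'cV[R]_m.+1, ip (A *m v) (A *m w) = ip v w) /\
           (forall v, forward_cone v -> forward_cone (A *m v))].

Definition SOplus m : set 'M[R]_m.+1 := connected_component (@Oplus m) 1%:M.

Definition SO m : set 'M[R]_m := [set B | B^T *m B = 1%:M /\ \det B = 1].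

Definition sphere_point m (Y : 'cV[R]_m.+1) : 'cV[R]_m :=
  \col_i (Y (lift ord0 i) ord0 / Y ord0 ord0).

Definition dot m (v w : 'cV[R]_m) : R := (v^T *m w) ord0 ord0.

Variable n : nat.

Definition G : set 'M[R]_n.+4 := @SOplus n.+3.

Definition K : set 'M[R]_n.+4 :=
  [set (block_mx A 0 0 B : 'M[R]_(4 + n)) | A in @SOplus 3 & B in @SO n].

Definition S0 : 'M[R]_n.+4 := (block_mx (- 1%:M) 0 0 1%:M : 'M[R]_(4 + n)).
Definition sigma (X : 'M[R]_n.+4) : 'M[R]_n.+4 := S0 *m X *m invmx S0.
Definition kpart (X : 'M[R]_n.+4) : 'M[R]_n.+4 := 2^-1 *: (X + sigma X).
Definition ppart (X : 'M[R]_n.+4) : 'M[R]_n.+4 := 2^-1 *: (X - sigma X).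

Definition Ptilde : 'M[R]_n.+4 :=
  diag_mx (\row_i (if val i == 4%N then -1 else 1)).

(* Points of G/K are the left cosets themselves. *)
Definition coset (g : 'M[R]_n.+4) : set 'M[R]_n.+4 := [set g *m k | k in K].
Definition GmodK : set (set 'M[R]_n.+4) := [set coset g | g in G].

(* On a coset gK this is A g K, resp. A g Ptilde K. *)
Definition act (A : 'M[R]_n.+4) (C : set 'M[R]_n.+4) : set 'M[R]_n.+4 :=
  if \det A == 1 then [set A *m g | g in C]
  else [set A *m g *m Ptilde *m k | g in C & k in K].

(* The 4-space g Span(e_0, ..., e_3) represented by C = gK; it does not depend
   on the choice of g in C because K preserves Span(e_0, ..., e_3). *)
Definition space_of (C : set 'M[R]_n.+4) : set 'cV[R]_n.+4 :=
  [set g *m (col_mx u 0 : 'cV[R]_(4 + n)) | g in C & u in [set: 'cV[R]_4]].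

(** * Maps into G/K *)

Definition lift_on (D : set (R * R)) (f : R * R -> set 'M[R]_n.+4)
    (F : R * R -> 'M[R]_n.+4) : Prop :=
  smooth_on D F /\ forall z, D z -> G (F z) /\ f z = coset (F z).

(* The coefficients of alpha = F^-1 dF = alphax dx + alphay dy. *)
Definition alphax (F : R * R -> 'M[R]_n.+4) z := invmx (F z) *m dx F z.
Definition alphay (F : R * R -> 'M[R]_n.+4) z := invmx (F z) *m dy F z.

Definition bracket (X Y : 'M[R]_n.+4) := X *m Y - Y *m X.

(* The tension field  nabla_x f_x + nabla_y f_y  of f, read in the frame F. *)
Definition tension (F : R * R -> 'M[R]_n.+4) z :=
  dx (fun w => ppart (alphax F w)) z
    + bracket (kpart (alphax F z)) (ppart (alphax F z))
  + dy (fun w => ppart (alphay F w)) z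
    + bracket (kpart (alphay F z)) (ppart (alphay F z)).

(* The vanishing of the tension is unchanged when F is replaced by F k with k
   valued in K, so one local lift around each point is enough. *)
Definition harmonic_on (D : set (R * R)) (f : R * R -> set 'M[R]_n.+4) :=
  forall z, D z -> exists U F,
    [/\ open U, U z, U `<=` D, lift_on U f F &
        forall w, U w -> tension F w = 0].

(* < f_z, f_z > = 0 for the invariant metric of G/K, which is a multiple of
   the trace form on p. *)
Definition conformal_on (D : set (R * R)) (f : R * R -> set 'M[R]_n.+4) :=
  forall z, D z -> exists U F,
    [/\ open U, U z, U `<=` D, lift_on U f F &
      forall w, U w ->
        let a := ppart (alphax F w) in let b := ppart (alphay F w) in
        \tr (a *m a) = \tr (b *m b) /\ \tr (a *m b) = 0].

(* With alpha'_p = a dz and alpha''_p = a^* dzbar, where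
   a = (ppart alphax - i ppart alphay) / 2, the two equations are the dx- and
   dy-coefficients of
     dF_lambda = F_lambda (lambda^-1 alpha'_p + alpha_k + lambda alpha''_p). *)
Definition extended_frame (D : set (R * R)) (F : R * R -> 'M[R]_n.+4)
    (Fl : R * R -> R * R -> 'M[R]_n.+4) : Prop :=
  forall lam, circle lam ->
    [/\ smooth_on D (Fl^~ lam), Fl 0 lam = 1%:M &
      forall z, D z ->
        let cpx := map_mx (real_complex R) in
        let l := toC lam in
        let a := 2^-1 *: (cpx (ppart (alphax F z))
                          - (0 +i* 1) *: cpx (ppart (alphay F z))) in
        let abar := 2^-1 *: (cpx (ppart (alphax F z))
                             + (0 +i* 1) *: cpx (ppart (alphay F z))) in
        [/\ G (Fl z lam),
            cpx (dx (Fl^~ lam) z) = cpx (Fl z lam) *m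
              (l^-1 *: a + cpx (kpart (alphax F z)) + l *: abar) &
            cpx (dy (Fl^~ lam) z) = cpx (Fl z lam) *m
              (l^-1 *: ((0 +i* 1) *: a) + cpx (kpart (alphay F z))
               + l *: (- (0 +i* 1) *: abar))]].

(** * Twisted loops *)

(* Loops are functions on the plane of which only the values on the circle
   matter; they carry the topology of uniform convergence on the circle. *)
Local Notation loop := {uniform` @circle R -> 'M[R]_n.+4}.

Definition twisted_loops : set loop :=
  [set g : loop | [/\ {within @circle R, continuous (g : R * R -> 'M[R]_n.+4)},
                      forall lam, circle lam -> G (g lam)
                    & forall lam, circle lam -> sigma (g lam) = g (- lam)]].

Definition twisted_loops0 : set loop :=
  connected_component twisted_loops ((fun=> 1%:M) : R * R -> 'M[R]_n.+4).

Definition monodromy_loop (chi : R * R -> 'M[R]_n.+4) : Prop :=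
  twisted_loops0 chi \/
  twisted_loops0 ((fun lam => chi lam *m Ptilde) : R * R -> 'M[R]_n.+4).

(** * Surfaces in S^(n+2) and their conformal Gauss maps *)

Definition conformal_immersion (D : set (R * R))
    (y : R * R -> 'cV[R]_n.+3) : Prop :=
  smooth_on D y /\
  forall z, D z ->
    [/\ dot (y z) (y z) = 1,
        dot (dx y z) (dx y z) = dot (dy y z) (dy y z),
        dot (dx y z) (dy y z) = 0 & 0 < dot (dx y z) (dx y z)].

(* The last equation is < Y_z, Y_zbar > = 1/2. *)
Definition canonical_lift (D : set (R * R)) (y : R * R -> 'cV[R]_n.+3)
    (Y : R * R -> 'cV[R]_n.+4) : Prop :=
  smooth_on D Y /\
  forall z, D z ->
    [/\ forward_cone (Y z), sphere_point (Y z) = y z &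
        ip (Re_dz Y z) (Re_dz Y z) + ip (Im_dz Y z) (Im_dz Y z) = 2^-1].

Definition gauss_space (Y : R * R -> 'cV[R]_n.+4) (z : R * R) :
    set 'cV[R]_n.+4 :=
  [set v | exists a b c d : R,
    v = a *: Y z + b *: Re_dz Y z + c *: Im_dz Y z + d *: dzdzbar Y z].

(* As in the notion of dual surfaces, 4-spaces are compared as subspaces: the
   bases (Y, Re Y_z, Im Y_z, Y_zzbar) of two dual surfaces induce opposite
   orientations on their common span. *)
Definition conformal_gauss_map (D : set (R * R)) (y : R * R -> 'cV[R]_n.+3)
    (f : R * R -> set 'M[R]_n.+4) : Prop :=
  exists2 Y, canonical_lift D y Y &
    forall z, D z -> GmodK (f z) /\ space_of (f z) = gauss_space Y z.

Definition willmore (D : set (R * R)) (y : R * R -> 'cV[R]_n.+3) : Prop :=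
  conformal_immersion D y /\
  exists2 f, conformal_gauss_map D y f & harmonic_on D f.

Definition induces (D : set (R * R)) (f : R * R -> set 'M[R]_n.+4)
    (y : R * R -> 'cV[R]_n.+3) : Prop :=
  willmore D y /\ conformal_gauss_map D y f.

(* A dual surface that reduces to a point is not an immersion, hence does not
   count as a second induced surface. *)
Definition induces_unique (D : set (R * R)) (f : R * R -> set 'M[R]_n.+4)
    (y : R * R -> 'cV[R]_n.+3) : Prop :=
  induces D f y /\
  forall y', induces D f y' -> forall z, D z -> y' z = y z.

(* Excluding further induced surfaces rules out a constant f: its 4-space cuts
   out a round 2-sphere, and every conformal immersion into it induces f. *)
Definition induces_dual_pair (D : set (R * R)) (f : R * R -> set 'M[R]_n.+4)
    (y yh : R * R -> 'cV[R]_n.+3) : Prop :=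
  [/\ induces D f y, induces D f yh, (exists2 z, D z & yh z <> y z) &
      forall y', induces D f y' -> 
        (forall z, D z -> y' z = y z) \/ (forall z, D z -> y' z = yh z)].

End Lorentz.

(* Main.v *)
Require Import Defs.
From HB Require Import structures.
From mathcomp Require Import all_boot all_order all_algebra.
From mathcomp Require Import all_classical all_reals all_analysis.
From mathcomp Require Import ring lra.

Set Implicit Arguments.
Unset Strict Implicit.
Unset Printing Implicit Defensive.

Import Order.TTheory GRing.Theory Num.Theory.
Import numFieldNormedType.Exports.

Local Open Scope classical_set_scope.
Local Open Scope ring_scope.

(** By hypothesis the surfaces induced by f_lambda are y alone, or y and its dual.  So it
    is enough to produce, from an induced surface y, another one related to y by the
    symmetry.  Put A = chi(lambda), h = gamma^-1, and let y1 be the surface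
    z |-> A y(h(z)), where A acts on the sphere as a Moebius transformation
    ([transformed_surface]).  If Y lifts y, then A Y(h(z)) / |h'|
    is the canonical lift of y1, and its 4-space at z is A applied to the 4-space of y at
    h(z) ([gauss_space_transformed]): rescaling a lift, applying a linear map and changing
    the parameter holomorphically all respect Span(Y, Re Y_z, Im Y_z, Y_zzbar), the last
    one because h is holomorphic and so the Laplacian is only scaled.  The symmetry
    f_lambda(gamma z) = A f_lambda(z) says that this 4-space is the one of f_lambda at z.
    Hence y1 is induced by f_lambda ([induces_transformed]), so y1 = y if the induced
    surface is unique, and y1 is y or its dual otherwise.  Evaluation at gamma(z) gives
    [A Y(z)] = y(gamma z), respectively the same with the dual surface on the right.

    That y1 is again Willmore needs a harmonic map with its 4-spaces.  It is obtained by
    transporting the one of y: a local frame F becomes A (F o h) Q, where Q is 1 or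
    [Ptilde] according to which of chi and chi Ptilde lies in the identity component, and
    the tension of the new frame is |h'|^2 times the conjugate by Q of the tension of F
    at h(z) ([tension_translate]).  This and the Laplacian of a lift are two cases of one
    computation ([divergence_comp]), which rests on the Cauchy-Riemann
    equations of h' and hence on the symmetry of second derivatives ([derive_sym]). *)

(** * Calculus on open subsets of the plane *)

Section PlaneCalculus.
Context {R : realType}.
Implicit Types (V W : normedModType R) (D U : set (R * R)).

Lemma near_open D (P : R * R -> Prop) z :
  open D -> D z -> (forall w, D w -> P w) -> \near z, P z.
Proof. by move=> oD Dz DP; apply: filterS (open_nbhs_nbhs (conj oD Dz)). Qed.

Lemma near_eq_differentiable V W (f g : V -> W) (a : V) :
  (\near a, f a = g a) -> differentiable f a -> differentiable g a.
Proof.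
move=> fg df.
have -> : g = f + (g - f) by rewrite addrC subrK.
apply: differentiableD; first exact: df.
have gf0 : \near a, (g - f) a = 0.
  by apply: filterS fg => x fgx; rewrite -[LHS]/(g x - f x) fgx subrr.
have E : (g - f) \o shift a = cst ((g - f) a) + (\0 : {linear V -> W}) +o_ 0 id.
  apply/eqaddoP => _ /posnumP[e].
  rewrite (nbhs_singleton gf0).
  move: gf0; rewrite (near_shift 0 a) => gf0.
  apply: filterS gf0 => x /=; rewrite subr0 => gf0.
  rewrite -[X in `|X|]/((g - f) (x + a) - (0 + 0)) gf0 addr0 subr0 normr0.
  by rewrite mulr_ge0.
have c0 : continuous (\0 : {linear V -> W}) by move=> ?; exact: cvg_cst.
have d0 := diff_unique c0 E.
by apply/diff_locallyP; rewrite d0.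
Qed.

Lemma derive_congr V D (f g : R * R -> V) v z :
  open D -> D z -> (forall w, D w -> f w = g w) -> 'D_v f z = 'D_v g z.
Proof. by move=> oD Dz fg; apply: near_eq_derive; exact: near_open fg. Qed.

Lemma dx_congr V D (f g : R * R -> V) z :
  open D -> D z -> (forall w, D w -> f w = g w) -> dx f z = dx g z.
Proof. exact: derive_congr. Qed.

Lemma dy_congr V D (f g : R * R -> V) z :
  open D -> D z -> (forall w, D w -> f w = g w) -> dy f z = dy g z.
Proof. exact: derive_congr. Qed.

Lemma differentiable_congr V D (f g : R * R -> V) z :
  open D -> D z -> (forall w, D w -> f w = g w) ->
  differentiable f z -> differentiable g z.
Proof.
by move=> oD Dz fg; apply: near_eq_differentiable; exact: near_open fg.
Qed.

(** Maps that are only known on D, such as the derivatives given by the product and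
    chain rules, are compared through this lemma in the inductions on the order of
    differentiability. *)
Lemma Ck_congr V k D (f g : R * R -> V) :
  open D -> (forall z, D z -> f z = g z) -> Ck_on k D f -> Ck_on k D g.
Proof.
move=> oD; elim: k f g => [|k IH] f g fg /=.
  move=> cf z Dz; have fz := cf z Dz.
  apply: cvg_trans (_ : f @ z --> g z); last by rewrite -(fg z Dz); exact: fz.
  by apply: near_eq_cvg; exact: near_open fg.
case=> df cx cy; split.
- by move=> z Dz; exact: differentiable_congr fg (df z Dz).
- by apply: IH cx => z Dz; exact: derive_congr fg.
- by apply: IH cy => z Dz; exact: derive_congr fg.
Qed.

Lemma Ck_sub V k D U (f : R * R -> V) : U `<=` D -> Ck_on k D f -> Ck_on k U f.
Proof.
move=> UD; elim: k f => [|k IH] f /=; first by move=> cf z /UD; exact: cf.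
by case=> df cx cy; split; [move=> z /UD; exact: df|exact: IH|exact: IH].
Qed.

Lemma CkW V k D (f : R * R -> V) : Ck_on k.+1 D f -> Ck_on k D f.
Proof.
elim: k f => [|k IH] f [df cx cy].
  by move=> z Dz; apply: differentiable_continuous; exact: df.
by split; [exact: df|exact: (IH _ cx)|exact: (IH _ cy)].
Qed.

Lemma Ck_cst V k D (a : V) : Ck_on k D (cst a).
Proof.
elim: k a => [|k IH] a /=; first by move=> z _; exact: cst_continuous.
split; first by move=> z _; exact: differentiable_cst.
- suff -> : dx (cst a : R * R -> V) = cst 0 by [].
  by apply/funext => z; rewrite /dx derive_cst.
- suff -> : dy (cst a : R * R -> V) = cst 0 by [].
  by apply/funext => z; rewrite /dy derive_cst.
Qed.

Lemma CkD V k D (f g : R * R -> V) : open D ->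
  Ck_on k D f -> Ck_on k D g -> Ck_on k D (fun z => f z + g z).
Proof.
move=> oD; elim: k f g => [|k IH] f g /=.
  by move=> cf cg z Dz; apply: continuousD; [exact: cf|exact: cg].
move=> [df fx fy] [dg gx gy]; split.
- by move=> z Dz; apply: differentiableD; [exact: df|exact: dg].
- apply: Ck_congr oD _ (IH _ _ fx gx) => z Dz /=.
  by rewrite /dx deriveD//; apply: diff_derivable; [exact: df|exact: dg].
- apply: Ck_congr oD _ (IH _ _ fy gy) => z Dz /=.
  by rewrite /dy deriveD//; apply: diff_derivable; [exact: df|exact: dg].
Qed.

Lemma CkM k D (u v : R * R -> R) : open D ->
  Ck_on k D u -> Ck_on k D v -> Ck_on k D (fun z => u z * v z).
Proof.
move=> oD; elim: k u v => [|k IH] u v.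
  by move=> cf cg z Dz; apply: continuousM; [exact: cf|exact: cg].
move=> Cu Cv; have Cu' := CkW Cu; have Cv' := CkW Cv.
case: Cu Cv => [du ux uy] [dv vx vy]; split.
- by move=> z Dz; apply: differentiableM; [exact: du|exact: dv].
- apply: Ck_congr oD _ (CkD oD (IH _ _ Cu' vx) (IH _ _ Cv' ux)) => z Dz /=.
  by rewrite /dx deriveM//; apply: diff_derivable; [exact: du|exact: dv].
- apply: Ck_congr oD _ (CkD oD (IH _ _ Cu' vy) (IH _ _ Cv' uy)) => z Dz /=.
  by rewrite /dy deriveM//; apply: diff_derivable; [exact: du|exact: dv].
Qed.

Lemma CkV k D (u : R * R -> R) : open D -> (forall z, D z -> u z != 0) ->
  Ck_on k D u -> Ck_on k D (fun z => (u z)^-1).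
Proof.
move=> oD u0; elim: k => [|k IH].
  by move=> cu z Dz; apply: continuousV; [exact: u0|exact: cu].
move=> Cu; have Cv := IH (CkW Cu); case: Cu => [du ux uy].
(* (1/u)' = - (1/u)^2 u', where 1/u is C^k by induction. *)
have Cm := CkM oD (Ck_cst k D (-1 : R)) (CkM oD Cv Cv).
split.
- by move=> z Dz; apply: differentiableV; [exact: du|exact: u0].
- apply: Ck_congr oD _ (CkM oD Cm ux) => z Dz /=.
  rewrite /dx [RHS]deriveV ?u0//; last exact/diff_derivable/du.
  by rewrite /GRing.scale/= mulN1r expr2 invfM.
- apply: Ck_congr oD _ (CkM oD Cm uy) => z Dz /=.
  rewrite /dy [RHS]deriveV ?u0//; last exact/diff_derivable/du.
  by rewrite /GRing.scale/= mulN1r expr2 invfM.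
Qed.

Lemma is_diff_sqrt (u : R * R -> R) z : differentiable u z -> 0 < u z ->
  differentiable (fun w => Num.sqrt (u w)) z /\
  forall v, 'D_v (fun w => Num.sqrt (u w)) z = (2 * Num.sqrt (u z))^-1 * 'D_v u z.
Proof.
move=> du u0; have [ds es] := is_derive1_sqrt u0.
have ds' : differentiable (@Num.sqrt R) (u z) by exact/derivable1_diffP.
have dsu := differentiable_comp du ds'.
split; first exact: dsu.
move=> v; rewrite (deriveE v dsu) (deriveE v du) mulrC -es -derive1E.
exact: etrans (congr1 (fun g => g v) (diff_comp du ds'))
  (congr1 (fun g => g ('d u z v)) (deriv1E ds)).
Qed.

Lemma Ck_sqrt k D (u : R * R -> R) : open D -> (forall z, D z -> 0 < u z) ->
  Ck_on k D u -> Ck_on k D (fun z => Num.sqrt (u z)).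
Proof.
move=> oD u0; elim: k => [|k IH].
  by move=> cu z Dz; apply: continuous_comp; [exact: cu|exact: sqrt_continuous].
move=> Cu; have Cs := IH (CkW Cu); case: Cu => [du ux uy].
have Cv : Ck_on k D (fun z => (2 * Num.sqrt (u z))^-1).
  apply: CkV oD _ (CkM oD (Ck_cst k D (2 : R)) Cs) => z Dz /=.
  by rewrite mulf_neq0// sqrtr_eq0 -ltNge u0.
have dS z (Dz : D z) := is_diff_sqrt (du z Dz) (u0 z Dz).
split; first by move=> z /dS[].
- by apply: Ck_congr oD _ (CkM oD Cv ux) => z /dS[_ E]; rewrite /dx E.
- by apply: Ck_congr oD _ (CkM oD Cv uy) => z /dS[_ E]; rewrite /dy E.
Qed.

Lemma differentiable_linear_comp V W (L : {linear V -> W}) (f : R * R -> V) z :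
  continuous L -> differentiable f z -> differentiable (L \o f) z.
Proof.
by move=> cL df; apply: differentiable_comp => //; exact: linear_differentiable.
Qed.

Lemma derive_linear_comp V W (L : {linear V -> W}) (f : R * R -> V) v z :
  continuous L -> differentiable f z -> 'D_v (L \o f) z = L ('D_v f z).
Proof.
move=> cL df; rewrite !deriveE//; last exact: differentiable_linear_comp.
by rewrite diff_comp//; [rewrite diff_lin|exact: linear_differentiable].
Qed.

Lemma Ck_linear_comp V W (L : {linear V -> W}) k D (f : R * R -> V) :
  continuous L -> open D -> Ck_on k D f -> Ck_on k D (L \o f).
Proof.
move=> cL oD; elim: k f => [|k IH] f /=.
  by move=> cf z Dz; apply: continuous_comp; [exact: cf|exact: cL].
move=> [df fx fy]; split.
- by move=> z Dz; apply: differentiable_linear_comp; [exact: cL|exact: df].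
- apply: Ck_congr oD _ (IH _ fx) => z Dz.
  by rewrite /= /dx derive_linear_comp//; exact: df.
- apply: Ck_congr oD _ (IH _ fy) => z Dz.
  by rewrite /= /dy derive_linear_comp//; exact: df.
Qed.

Lemma Ck_fst k D (h : R * R -> R * R) : open D ->
  Ck_on k D h -> Ck_on k D (fun z => (h z).1).
Proof. by apply: (@Ck_linear_comp _ _ fst) => z; exact: cvg_fst. Qed.

Lemma Ck_snd k D (h : R * R -> R * R) : open D ->
  Ck_on k D h -> Ck_on k D (fun z => (h z).2).
Proof. by apply: (@Ck_linear_comp _ _ snd) => z; exact: cvg_snd. Qed.

Lemma derive_fst (h : R * R -> R * R) v z : differentiable h z ->
  'D_v (fun w => (h w).1) z = ('D_v h z).1.
Proof. by apply: (@derive_linear_comp _ _ fst) => w; exact: cvg_fst. Qed.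

Lemma derive_snd (h : R * R -> R * R) v z : differentiable h z ->
  'D_v (fun w => (h w).2) z = ('D_v h z).2.
Proof. by apply: (@derive_linear_comp _ _ snd) => w; exact: cvg_snd. Qed.

Lemma linear_planeE V (L : R * R -> V) (p : R * R) :
  (forall a q r, L (a *: q + r) = a *: L q + L r) ->
  L p = p.1 *: L (1, 0) + p.2 *: L (0, 1).
Proof.
move=> L_lin; rewrite -[p.2 *: _]addr0.
have L0 : L 0 = 0.
  by have := L_lin (-1) 0 0; rewrite scaler0 addr0 scaleN1r addNr.
rewrite -L0 -!L_lin; congr L.
by case: p => a b; congr (_, _); rewrite /= /GRing.scale/= ?mulr1 ?mulr0;
   rewrite ?addr0 ?add0r.
Qed.

Lemma derive_chain V (f : R * R -> V) (h : R * R -> R * R) v z :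
  differentiable h z -> differentiable f (h z) ->
  'D_v (f \o h) z = ('D_v h z).1 *: dx f (h z) + ('D_v h z).2 *: dy f (h z).
Proof.
move=> dh df; have dfh : differentiable (f \o h) z by exact: differentiable_comp.
rewrite /dx /dy (deriveE v dfh) (deriveE v dh) !(deriveE _ df).
apply: etrans (congr1 (fun g => g v) (diff_comp dh df)) _.
have L (a : R) (q r : R * R) :
    'd f (h z) (a *: q + r) = a *: 'd f (h z) q + 'd f (h z) r.
  exact: linearP.
exact: (linear_planeE ('d h z v) L).
Qed.

Lemma Ck_comp k D U (u : R * R -> R) (h : R * R -> R * R) :
  open D -> (forall z, D z -> U (h z)) -> Ck_on k D h -> Ck_on k U u ->
  Ck_on k D (u \o h).
Proof.
move=> oD hU; elim: k u => [|k IH] u.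
  move=> ch cu z Dz; apply: continuous_comp; [exact: ch|exact/cu/hU].
move=> Ch Cu; have Ch' := CkW Ch.
case: Ch Cu => [dh hx hy] [du ux uy]; split.
- by move=> z Dz; apply: differentiable_comp; [exact: dh|exact/du/hU].
- apply: (Ck_congr oD) (CkD oD
    (CkM oD (Ck_fst oD hx) (IH _ Ch' ux)) (CkM oD (Ck_snd oD hx) (IH _ Ch' uy))).
  by move=> z Dz; rewrite [in RHS]/dx derive_chain//; [exact: dh|exact/du/hU].
- apply: (Ck_congr oD) (CkD oD
    (CkM oD (Ck_fst oD hy) (IH _ Ch' ux)) (CkM oD (Ck_snd oD hy) (IH _ Ch' uy))).
  by move=> z Dz; rewrite [in RHS]/dy derive_chain//; [exact: dh|exact/du/hU].
Qed.

End PlaneCalculus.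

(** * Symmetry of the second derivatives *)

Section Schwarz.
Context {R : realType}.
Implicit Types (D : set (R * R)) (u : R * R -> R).

Lemma is_derive_line u (c v : R * R) (s : R) : differentiable u (s *: v + c) ->
  is_derive s 1 (fun t : R => u (t *: v + c)) ('D_v u (s *: v + c)).
Proof.
move=> du.
have dl : is_diff s (fun t : R => t *: v + c) ( *:%R^~ v + 0).
  exact: (is_diffD (is_diff_scalel _ _) (is_diff_cst _ _)).
have dul : differentiable (fun t : R => u (t *: v + c)) s.
  by apply: (@differentiable_comp _ _ _ _ (fun t : R => t *: v + c) u).
have E := diff_comp (ex_diff (is_diff_def := dl)) du.
split; first exact: diff_derivable.
rewrite deriveE// (deriveE v du).
apply: etrans (congr1 (fun g => g 1) E) _.
rewrite [LHS]/comp diff_val.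
by congr ('d u _ _); rewrite -[LHS]/(1 *: v + 0) scale1r addr0.
Qed.

Definition second_difference u (z v w : R * R) (t : R) : R :=
  u (t *: v + (t *: w + z)) - u (t *: v + z) - (u (t *: w + z) - u z).

(** The mean value theorem in direction v turns the second difference into t times a
    first difference of the derivative along v, which is then expanded to first order
    at z. *)
Lemma second_difference_bound D u (z v w : R * R) (e : R) :
  open D -> D z -> (forall p, D p -> differentiable u p) ->
  differentiable (fun p => 'D_v u p) z -> 0 < e ->
  \forall t \near 0^'+,
   `|second_difference u z v w t - t ^+ 2 * 'D_w (fun p => 'D_v u p) z| <= e * t ^+ 2.
Proof.
move=> oD Dz du dg e0; set g := fun p => _ in dg *.
have M0 : 0 < `|v| + `|w| + 1 by rewrite ltr_wpDl// addr_ge0.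
set M := `|v| + `|w| + 1 in M0.
(* The first order expansion is used at two points of norm at most t * M, each
   contributing half of the error e * t. *)
have e1 : 0 < e / (2 * M) by rewrite divr_gt0// mulr_gt0.
have lin : \forall k \near (0 : R * R),
    D (k + z) /\ `|g (k + z) - (g z + 'd g z k)| <= e / (2 * M) * `|k|.
  apply: filterS2 (_ : \forall k \near (0 : R * R), D (k + z)) _ => [k Dk gk||].
  - by split; [exact: Dk|exact: gk].
  - have : \near z, D z by exact: near_open oD Dz _.
    by rewrite (near_shift 0 z); apply: filterS => k /=; rewrite subr0.
  - by have /eqaddoP /(_ _ e1) := diff_locally dg.
have [r r0 {}lin] : exists2 r : R, 0 < r & forall k : R * R, `|k| < r ->
    D (k + z) /\ `|g (k + z) - (g z + 'd g z k)| <= e / (2 * M) * `|k|.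
  move/nbhs_norm0P : lin => [r /= r0 lin]; exists r => // k kr; exact: lin.
near=> t.
have t0 : 0 < t by near: t; exact: nbhs_right_gt.
have tr : t < r / M by near: t; apply: nbhs_right_lt; rewrite divr_gt0.
have small s a : 0 <= s <= t -> 0 <= a <= t -> `|s *: v + a *: w| <= t * M.
  move=> /andP[s0 st] /andP[a0 a_t].
  rewrite (le_trans (ler_normD _ _))// !normrZ !ger0_norm//.
  rewrite /M !mulrDr mulr1 -[leLHS]addr0 lerD ?lerD ?ler_wpM2r// ltW//.
have tM : t * M < r by rewrite -ltr_pdivlMr.
have inD s a : 0 <= s <= t -> 0 <= a <= t -> D (s *: v + (a *: w + z)).
  move=> hs ha; rewrite addrA.
  exact: (lin _ (le_lt_trans (small _ _ hs ha) tM)).1.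
have t00 : 0 <= t <= t by apply/andP; split; [exact: ltW|exact: lexx].
have z00 : (0 : R) <= 0 <= t by apply/andP; split; [exact: lexx|exact: ltW].
have inD0 s : 0 <= s <= t -> D (s *: v + z).
  by move=> hs; have := inD s 0 hs z00; rewrite scale0r add0r.
pose phi s := u (s *: v + (t *: w + z)) - u (s *: v + z).
have dphi s : 0 <= s <= t ->
    is_derive s 1 phi (g (s *: v + (t *: w + z)) - g (s *: v + z)).
  move=> hs; apply: is_deriveB; apply: is_derive_line; apply: du.
    exact: inD.
  exact: inD0.
have [||xi xit phiE] := @MVT _ phi
    (fun s => g (s *: v + (t *: w + z)) - g (s *: v + z)) 0 t t0.
- by move=> s; rewrite in_itv/= => /andP[s0 st]; apply: dphi; rewrite !ltW.
- apply: continuous_in_subspaceT => s; rewrite inE/= in_itv/= => hs.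
  have ds : derivable phi s 1 := ex_derive (is_derive := dphi s hs).
  exact/differentiable_continuous/derivable1_diffP.
have hxi : 0 <= xi <= t by move: xit; rewrite in_itv/= => /andP[? ?]; rewrite !ltW.
have -> : second_difference u z v w t = phi t - phi 0.
  by rewrite /phi /second_difference !scale0r !add0r.
rewrite phiE subr0 (deriveE w dg) mulrC expr2 -mulrA -mulrBr normrM (gtr0_norm t0).
rewrite mulrCA ler_pM2l//.
have [_ l1] := lin _ (le_lt_trans (small _ _ hxi t00) tM).
have [_ l0] := lin _ (le_lt_trans (small _ _ hxi z00) tM).
rewrite -addrA in l1; rewrite scale0r addr0 in l0.
have s1 := small _ _ hxi t00; have s0 := small _ _ hxi z00.
rewrite scale0r addr0 in s0.
have lt1 := le_trans l1 (ler_wpM2l (ltW e1) s1).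
have lt0 := le_trans l0 (ler_wpM2l (ltW e1) s0).
have eM : e / (2 * M) * (t * M) = e * t / 2.
  by field; rewrite gt_eqF.
rewrite eM in lt1 lt0.
have dgE : 'd g z (xi *: v + t *: w) = 'd g z (xi *: v) + t * 'd g z w.
  by rewrite linearD; congr (_ + _); exact: linearZ.
rewrite dgE in lt1.
rewrite (_ : _ - _ =
   (g (xi *: v + (t *: w + z)) - (g z + ('d g z (xi *: v) + t * 'd g z w)))
   - (g (xi *: v + z) - (g z + 'd g z (xi *: v)))); last by ring.
by rewrite (le_trans (ler_normB _ _))// (le_trans (lerD lt1 lt0))// -splitr.
Unshelve. all: by end_near. Qed.

Lemma second_differenceC u z v w t :
  second_difference u z v w t = second_difference u z w v t.
Proof. by rewrite /second_difference addrCA; ring. Qed.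

(** Both mixed derivatives are the limit of the same second difference quotient,
    so differentiability of the first derivatives suffices for symmetry. *)
Lemma derive_sym D u (z v w : R * R) :
  open D -> D z -> (forall p, D p -> differentiable u p) ->
  differentiable (fun p => 'D_v u p) z -> differentiable (fun p => 'D_w u p) z ->
  'D_w (fun p => 'D_v u p) z = 'D_v (fun p => 'D_w u p) z.
Proof.
move=> oD Dz du dv dw; apply/eqP; rewrite -subr_eq0 -normr_le0.
apply/ler_addgt0Pl => e e0; rewrite addr0.
have e2 : 0 < e / 2 by rewrite divr_gt0.
have n1 := second_difference_bound w oD Dz du dv e2.
have n2 := second_difference_bound v oD Dz du dw e2.
have [t [[h1 h2] t0]] : exists t,
   (`|second_difference u z v w t - t ^+ 2 * 'D_w (fun p => 'D_v u p) z|
      <= e / 2 * t ^+ 2 /\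
    `|second_difference u z w v t - t ^+ 2 * 'D_v (fun p => 'D_w u p) z|
      <= e / 2 * t ^+ 2) /\ 0 < t.
  apply: (@filter_ex _ (0 : R)^'+).
  exact: (filterI (filterI n1 n2) (nbhs_right_gt (0 : R))).
rewrite (second_differenceC u z w v) in h2.
move: h1 h2; move: ('D_w _ z) ('D_v _ z) (second_difference _ _ _ _ _) => a b d h1 h2.
rewrite distrC in h1.
have := le_trans (ler_normD _ _) (lerD h1 h2).
rewrite addrA subrK -mulrBr normrM ger0_norm ?sqr_ge0// -mulrDl -splitr [leRHS]mulrC.
by rewrite ler_pM2l// exprn_gt0.
Qed.
End Schwarz.

(** * Calculus of matrix-valued maps *)

Section MatrixCalculus.
Context {R : realType}.
Implicit Types (D : set (R * R)).

Lemma differentiable_entry (E : normedModType R) m n (M : E -> 'M[R]_(m, n)) z i j :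
  differentiable M z -> differentiable (fun w => M w i j) z.
Proof.
move=> dM; apply: (@differentiable_comp _ E _ _ M (fun N : 'M[R]_(m, n) => N i j)) => //.
exact: differentiable_coord.
Qed.

Lemma derive_entry m n (M : R * R -> 'M[R]_(m, n)) z v i j :
  differentiable M z -> ('D_v M z) i j = 'D_v (fun w => M w i j) z.
Proof. by move=> dM; rewrite derive_mx ?mxE//; exact: diff_derivable. Qed.

Lemma differentiable_mx (E : normedModType R) m n (M : E -> 'M[R]_(m, n)) z :
  (forall i j, differentiable (fun w => M w i j) z) -> differentiable M z.
Proof.
move=> dM.
have -> : M =
    \sum_(i < m) \sum_(j < n) (fun w => M w i j *: (delta_mx i j : 'M[R]_(m, n))).
  apply/funext => w; rewrite [LHS]matrix_sum_delta !fct_sumE.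
  by apply: eq_bigr => i _; rewrite fct_sumE.
apply: differentiable_sum => i; apply: differentiable_sum => j.
exact: differentiableZl.
Qed.

Lemma derive_mx_eq m n (M : R * R -> 'M[R]_(m, n)) (N : 'M[R]_(m, n)) z v :
  differentiable M z -> (forall i j, 'D_v (fun w => M w i j) z = N i j) ->
  'D_v M z = N.
Proof. by move=> dM E; apply/matrixP => i j; rewrite derive_entry. Qed.

Lemma Ck_scalel (V : normedModType R) (a : V) k D (u : R * R -> R) : open D ->
  Ck_on k D u -> Ck_on k D (fun z => u z *: a).
Proof.
move=> oD; elim: k u => [|k IH] u.
  by move=> cu z Dz; apply: cvgZr_tmp; exact: cu.
move=> [du ux uy].
have E v z : D z -> 'D_v u z *: a = 'D_v (fun w => u w *: a) z.
  move=> Dz; rewrite (deriveE v (du z Dz)).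
  rewrite (deriveE v (differentiableZl a (du z Dz))).
  exact: esym (congr1 (fun g => g v) (diffZl a (du z Dz))).
split; first by move=> z Dz; apply: differentiableZl; exact: du.
- by apply: Ck_congr oD _ (IH _ ux) => z; exact: E.
- by apply: Ck_congr oD _ (IH _ uy) => z; exact: E.
Qed.

Lemma Ck_sum (V : normedModType R) (I : Type) (r : seq I) k D (f : I -> R * R -> V) :
  open D -> (forall i, Ck_on k D (f i)) ->
  Ck_on k D (fun z => \sum_(i <- r) f i z).
Proof.
move=> oD Cf; elim: r => [|i r IH].
  by apply: Ck_congr oD _ (Ck_cst k D (0 : V)) => z _; rewrite big_nil.
by apply: Ck_congr oD _ (CkD oD (Cf i) IH) => z _; rewrite big_cons.
Qed.

Lemma Ck_mx m n k D (M : R * R -> 'M[R]_(m, n)) : open D ->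
  (forall i j, Ck_on k D (fun w => M w i j)) -> Ck_on k D M.
Proof.
move=> oD CM.
have C := Ck_sum (index_enum 'I_m) oD (fun i => Ck_sum (index_enum 'I_n) oD
  (fun j => Ck_scalel (delta_mx i j : 'M[R]_(m, n)) oD (CM i j))).
by apply: Ck_congr oD _ C => z _; rewrite [RHS]matrix_sum_delta.
Qed.

Lemma Ck_entry m n k D (M : R * R -> 'M[R]_(m, n)) i j : open D ->
  Ck_on k D M -> Ck_on k D (fun w => M w i j).
Proof.
move=> oD; elim: k M => [|k IH] M.
  move=> cM z Dz; apply: (@continuous_comp _ _ _ M (fun N : 'M[R]_(m, n) => N i j)).
    exact: cM.
  exact: coord_continuous.
move=> [dM Mx My]; split.
- by move=> z Dz; apply: differentiable_entry; exact: dM.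
- apply: Ck_congr oD _ (IH _ Mx) => z Dz; rewrite /dx derive_entry//; exact: dM.
- apply: Ck_congr oD _ (IH _ My) => z Dz; rewrite /dy derive_entry//; exact: dM.
Qed.

Lemma CkZ m n k D (s : R * R -> R) (M : R * R -> 'M[R]_(m, n)) : open D ->
  Ck_on k D s -> Ck_on k D M -> Ck_on k D (fun z => s z *: M z).
Proof.
move=> oD Cs CM; apply: (Ck_mx oD) => i j.
apply: Ck_congr oD _ (CkM oD Cs (Ck_entry i j oD CM)) => z _.
by rewrite mxE.
Qed.

Lemma Ck_mulmx m n p k D (M : R * R -> 'M[R]_(m, n)) (N : R * R -> 'M[R]_(n, p)) :
  open D -> Ck_on k D M -> Ck_on k D N -> Ck_on k D (fun z => M z *m N z).
Proof.
move=> oD CM CN; apply: (Ck_mx oD) => i j.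
have C := Ck_sum (index_enum 'I_n) oD
  (fun l => CkM oD (Ck_entry i l oD CM) (Ck_entry l j oD CN)).
by apply: Ck_congr oD _ C => z _; rewrite mxE.
Qed.

Lemma Ck_trmx m n k D (M : R * R -> 'M[R]_(m, n)) :
  open D -> Ck_on k D M -> Ck_on k D (fun z => (M z)^T).
Proof.
move=> oD CM; apply: (Ck_mx oD) => i j.
by apply: Ck_congr oD _ (Ck_entry j i oD CM) => z _; rewrite mxE.
Qed.

Lemma Ck_mx_comp m n k D U (M : R * R -> 'M[R]_(m, n)) (h : R * R -> R * R) :
  open D -> open U -> (forall z, D z -> U (h z)) -> Ck_on k D h -> Ck_on k U M ->
  Ck_on k D (fun z => M (h z)).
Proof.
move=> oD oU hU Ch CM; apply: (Ck_mx oD) => i j.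
exact: (Ck_comp oD hU Ch (Ck_entry i j oU CM)).
Qed.

Lemma differentiable_mulmx (E : normedModType R) m n p (M : E -> 'M[R]_(m, n))
    (N : E -> 'M[R]_(n, p)) z :
  differentiable M z -> differentiable N z -> differentiable (fun w => M w *m N w) z.
Proof.
move=> dM dN; apply: differentiable_mx => i j.
have -> : (fun w => (M w *m N w) i j) =
    \sum_l ((fun w => M w i l) * (fun w => N w l j)).
  by apply/funext => w; rewrite mxE fct_sumE.
by apply: differentiable_sum => l; apply: differentiableM; exact: differentiable_entry.
Qed.

Lemma derive_mulmx m n p (M : R * R -> 'M[R]_(m, n)) (N : R * R -> 'M[R]_(n, p)) z v :
  differentiable M z -> differentiable N z ->
  'D_v (fun w => M w *m N w) z = 'D_v M z *m N z + M z *m 'D_v N z.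
Proof.
move=> dM dN; apply: derive_mx_eq => [|i j]; first exact: differentiable_mulmx.
have -> : (fun w => (M w *m N w) i j) =
    \sum_l ((fun w => M w i l) * (fun w => N w l j)).
  by apply/funext => w; rewrite mxE fct_sumE.
have dMe l : derivable (fun w => M w i l) z v.
  exact/diff_derivable/differentiable_entry.
have dNe l : derivable (fun w => N w l j) z v.
  exact/diff_derivable/differentiable_entry.
rewrite derive_sum => [|l]; last exact: derivableM.
rewrite !mxE -big_split; apply: eq_bigr => l _ /=.
rewrite (deriveM (dMe l) (dNe l)) !derive_entry// /GRing.scale/= addrC.
by rewrite [_ * N z l j]mulrC.
Qed.

Lemma differentiable_scalemx m n (s : R * R -> R) (M : R * R -> 'M[R]_(m, n)) z :
  differentiable s z -> differentiable M z -> differentiable (fun w => s w *: M w) z.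
Proof.
move=> ds dM; apply: differentiable_mx => i j.
have -> : (fun w => (s w *: M w) i j) = s * (fun w => M w i j).
  by apply/funext => w; rewrite mxE.
by apply: differentiableM => //; exact: differentiable_entry.
Qed.

Lemma derive_scalemx m n (s : R * R -> R) (M : R * R -> 'M[R]_(m, n)) z v :
  differentiable s z -> differentiable M z ->
  'D_v (fun w => s w *: M w) z = s z *: 'D_v M z + 'D_v s z *: M z.
Proof.
move=> ds dM; apply: derive_mx_eq => [|i j]; first exact: differentiable_scalemx.
have -> : (fun w => (s w *: M w) i j) = s * (fun w => M w i j).
  by apply/funext => w; rewrite mxE.
have dMe : derivable (fun w => M w i j) z v.
  exact/diff_derivable/differentiable_entry.
rewrite (deriveM (diff_derivable ds) dMe).
by rewrite !mxE derive_entry// /GRing.scale/= [_ * 'D_v s z]mulrC.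
Qed.

End MatrixCalculus.

(** * Holomorphic changes of the parameter *)

Section HolomorphicChange.
Context {R : realType}.
Variables (D : set (R * R)) (h : R * R -> R * R).
Hypotheses (oD : open D) (hol : holomorphic_on D h).

(** The real and imaginary parts of the complex derivative h', and its squared
    modulus, by which h pulls back the flat metric. *)
Definition re_deriv (h : R * R -> R * R) (z : R * R) : R := (dx h z).1.
Definition im_deriv (h : R * R -> R * R) (z : R * R) : R := (dx h z).2.
Definition conformal_factor (h : R * R -> R * R) (z : R * R) : R :=
  re_deriv h z ^+ 2 + im_deriv h z ^+ 2.

Local Notation p := (re_deriv h).
Local Notation q := (im_deriv h).

Lemma hol_differentiable z : D z -> differentiable h z.
Proof. by have [sh _] := hol; have [dh _ _] := sh 1%N; exact: dh. Qed.

Lemma dx_comp (V : normedModType R) (f : R * R -> V) z :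
  D z -> differentiable f (h z) ->
  dx (fun w => f (h w)) z = p z *: dx f (h z) + q z *: dy f (h z).
Proof. by move=> Dz df; rewrite /dx [LHS]derive_chain//; exact: hol_differentiable. Qed.

Lemma dy_comp (V : normedModType R) (f : R * R -> V) z :
  D z -> differentiable f (h z) ->
  dy (fun w => f (h w)) z = - q z *: dx f (h z) + p z *: dy f (h z).
Proof.
move=> Dz df; rewrite [LHS]derive_chain//; last exact: hol_differentiable.
have [_ /(_ z Dz)[CR1 CR2]] := hol.
congr (_ *: _ + _ *: _); [exact: CR2|exact: esym CR1].
Qed.

Lemma smooth_re_deriv : smooth_on D p.
Proof. by move=> k; have [_ hx _] := hol.1 k.+1; exact: Ck_fst oD hx. Qed.

Lemma smooth_im_deriv : smooth_on D q.
Proof. by move=> k; have [_ hx _] := hol.1 k.+1; exact: Ck_snd oD hx. Qed.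

Lemma differentiable_re_deriv z : D z -> differentiable p z.
Proof. by have [dp _ _] := smooth_re_deriv 1%N; exact: dp. Qed.

Lemma differentiable_im_deriv z : D z -> differentiable q z.
Proof. by have [dp _ _] := smooth_im_deriv 1%N; exact: dp. Qed.

(** The complex derivative h' is itself holomorphic: these are its Cauchy-Riemann
    equations, which follow from those of h by symmetry of the second derivatives. *)
Lemma cauchy_riemann_deriv z : D z -> dx p z = dy q z /\ dx q z = - dy p z.
Proof.
move=> Dz; have [dh [dhx _ _] [dhy _ _]] := hol.1 2.
have [_ CR] := hol.
have d1 w : D w -> differentiable (fun w => (h w).1) w.
  move=> Dw; apply: (@differentiable_linear_comp _ _ _ fst); last exact: dh.
  by move=> v; exact: cvg_fst.
have d2 w : D w -> differentiable (fun w => (h w).2) w.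
  move=> Dw; apply: (@differentiable_linear_comp _ _ _ snd); last exact: dh.
  by move=> v; exact: cvg_snd.
have x1 w : D w -> 'D_(1, 0) (fun w => (h w).1) w = p w.
  by move=> Dw; rewrite derive_fst//; exact: dh.
have x2 w : D w -> 'D_(1, 0) (fun w => (h w).2) w = q w.
  by move=> Dw; rewrite derive_snd//; exact: dh.
have y1 w : D w -> 'D_(0, 1) (fun w => (h w).1) w = - q w.
  by move=> Dw; rewrite derive_fst; [exact: (CR w Dw).2|exact: dh].
have y2 w : D w -> 'D_(0, 1) (fun w => (h w).2) w = p w.
  by move=> Dw; rewrite derive_snd; [exact: esym (CR w Dw).1|exact: dh].
have dp := differentiable_re_deriv Dz; have dq := differentiable_im_deriv Dz.
split.
- rewrite -[LHS](derive_congr _ oD Dz y2) -[RHS](derive_congr _ oD Dz x2).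
  apply: esym; apply: (derive_sym oD Dz d2).
    by apply: differentiable_congr oD Dz _ dq => w /x2.
  by apply: differentiable_congr oD Dz _ dp => w /y2.
- rewrite -[dy p z](derive_congr _ oD Dz x1).
  rewrite (derive_sym oD Dz d1).
  + rewrite (derive_congr _ oD Dz y1) [X in - X]deriveN; first by rewrite opprK.
    exact: diff_derivable.
  + by apply: differentiable_congr oD Dz _ dp => w /x1.
  + apply: differentiable_congr oD Dz _ (differentiableN dq) => w /y1 ->.
    by [].
Qed.

(** If A dx + B dy is a one-form with values in matrices, the left-hand side is the
    divergence of its pull-back by h.  The terms in which h' is differentiated cancel
    by the Cauchy-Riemann equations of h'.  Both the Laplacian of a lift and the
    tension field of a frame transform by this formula. *)
Lemma divergence_comp m n (A B : R * R -> 'M[R]_(m, n)) z :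
  D z -> differentiable A (h z) -> differentiable B (h z) ->
  dx (fun w => p w *: A (h w) + q w *: B (h w)) z
  + dy (fun w => - q w *: A (h w) + p w *: B (h w)) z
  = conformal_factor h z *: (dx A (h z) + dy B (h z)).
Proof.
move=> Dz dA dB.
have dh := hol_differentiable Dz.
have dp := differentiable_re_deriv Dz; have dq := differentiable_im_deriv Dz.
have dAh : differentiable (fun w => A (h w)) z by exact: (differentiable_comp dh).
have dBh : differentiable (fun w => B (h w)) z by exact: (differentiable_comp dh).
have dNq : differentiable (fun w => - q w) z by exact: differentiableN.
have DD v (s t : R * R -> R) : differentiable s z -> differentiable t z ->
   'D_v (fun w => s w *: A (h w) + t w *: B (h w)) z =
   s z *: 'D_v (fun w => A (h w)) z + 'D_v s z *: A (h z) +
   (t z *: 'D_v (fun w => B (h w)) z + 'D_v t z *: B (h z)).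
  move=> ds dt.
  have sA : derivable _ z v := diff_derivable (differentiable_scalemx ds dAh).
  have tB : derivable _ z v := diff_derivable (differentiable_scalemx dt dBh).
  by rewrite (deriveD sA tB) (derive_scalemx v ds dAh) (derive_scalemx v dt dBh).
rewrite [X in X + _ = _](DD _ _ _ dp dq) [X in _ + X = _](DD _ _ _ dNq dp).
have [cr1 cr2] := cauchy_riemann_deriv Dz.
rewrite -!/(dx _ z) -!/(dy _ z).
rewrite (dx_comp Dz dA) (dx_comp Dz dB) (dy_comp Dz dA) (dy_comp Dz dB) cr1 cr2.
have -> : dy (fun w => - q w) z = - dy q z.
  by rewrite /dy [LHS]deriveN//; exact: diff_derivable.
rewrite /conformal_factor.
move: (dx A _) (dy A _) (dx B _) (dy B _) (A _) (B _) (p z) (q z) (dy p z) (dy q z).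
move=> a b c d e f s t ds dt; clear.
apply/matrixP => i j; rewrite !mxE; ring.
Qed.

Lemma dzdzbar_comp m n (f : R * R -> 'M[R]_(m, n)) U z :
  open U -> (forall w, D w -> U (h w)) -> Ck_on 2 U f -> D z ->
  dzdzbar (fun w => f (h w)) z = conformal_factor h z *: dzdzbar f (h z).
Proof.
move=> oU hU [df [dfx _ _] [dfy _ _]] Dz.
rewrite /dzdzbar scalerA mulrC -scalerA; congr (_ *: _).
rewrite -(divergence_comp Dz (dfx _ (hU _ Dz)) (dfy _ (hU _ Dz))).
have dfh w : D w -> differentiable f (h w) by move=> Dw; exact/df/hU.
have -> : dx (dx (fun w => f (h w))) z =
    dx (fun w => p w *: dx f (h w) + q w *: dy f (h w)) z.
  by apply: dx_congr oD Dz _ => w Dw; exact: dx_comp Dw (dfh w Dw).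
have -> : dy (dy (fun w => f (h w))) z =
    dy (fun w => - q w *: dx f (h w) + p w *: dy f (h w)) z.
  by apply: dy_congr oD Dz _ => w Dw; exact: dy_comp Dw (dfh w Dw).
by [].
Qed.

(** A differentiable left inverse forces h' to be nonzero, by the chain rule. *)
Lemma conformal_factor_gt0 (g : R * R -> R * R) z :
  D z -> differentiable g (h z) -> (forall w, D w -> g (h w) = w) ->
  0 < conformal_factor h z.
Proof.
move=> Dz dg gK; rewrite lt_def addr_ge0 ?sqr_ge0// andbT.
rewrite paddr_eq0 ?sqr_ge0// !sqrf_eq0; apply/negP => /andP[/eqP p0 /eqP q0].
have vanish (a b : R * R) (s t : R) : s = 0 -> t = 0 -> s *: a + t *: b = 0.
  by move=> -> ->; rewrite !scale0r addr0.
have dgh1 : dx (fun w => g (h w)) z = (1, 0).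
  by rewrite (dx_congr oD Dz gK) /dx derive_id.
have dgh0 := etrans (esym dgh1) (etrans (dx_comp Dz dg) (vanish _ _ _ _ p0 q0)).
by have /eqP := congr1 fst dgh0; rewrite /= oner_eq0.
Qed.

End HolomorphicChange.

(** * The Lorentz group and the homogeneous space G/K *)

Section LorentzGroup.
Context {R : realType}.

Section Form.
Variable m : nat.
Local Notation J := (Defs.minkowski R m).
Implicit Types (u v w : 'cV[R]_m.+1) (A B : 'M[R]_m.+1).

Lemma ipE v w : ip v w = - (v ord0 ord0 * w ord0 ord0)
  + \sum_(i < m) v (lift ord0 i) ord0 * w (lift ord0 i) ord0.
Proof.
rewrite /ip /Defs.minkowski mxE big_ord_recl; congr (_ + _).
  by rewrite mul_mx_diag !mxE eqxx mulrN1 mulNr.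
by apply: eq_bigr => i _; rewrite mul_mx_diag !mxE /= mulr1.
Qed.

Lemma ipC v w : ip v w = ip w v.
Proof.
rewrite !ipE mulrC; congr (_ + _).
by apply: eq_bigr => i _; rewrite mulrC.
Qed.

Lemma ipDl u v w : ip (u + v) w = ip u w + ip v w.
Proof. by rewrite /ip raddfD /= !mulmxDl mxE. Qed.

Lemma ipZl (a : R) v w : ip (a *: v) w = a * ip v w.
Proof. by rewrite /ip linearZ /= -!scalemxAl mxE. Qed.

Lemma ipDr u v w : ip w (u + v) = ip w u + ip w v.
Proof. by rewrite ipC ipDl !(ipC w). Qed.

Lemma ipZr (a : R) v w : ip w (a *: v) = a * ip w v.
Proof. by rewrite ipC ipZl (ipC w). Qed.

Lemma minkowskiK : J *m J = 1%:M.
Proof.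
rewrite mulmx_diag -diag_const_mx; congr diag_mx; apply/rowP => i.
by rewrite !mxE; case: ifP => _; rewrite ?mulrNN mulr1.
Qed.

Lemma mx_form_entry (M : 'M[R]_m.+1) i j :
  ((delta_mx i ord0 : 'cV[R]_m.+1)^T *m M *m (delta_mx j ord0 : 'cV_m.+1))
    ord0 ord0 = M i j.
Proof. by rewrite trmx_delta -rowE -colE !mxE. Qed.

Lemma isometry_form A :
  (forall v w, ip (A *m v) (A *m w) = ip v w) <-> A^T *m J *m A = J.
Proof.
split=> [Aip|AJ v w]; last by rewrite /ip trmx_mul -{2}AJ !mulmxA.
apply/matrixP => i j; rewrite -!mx_form_entry.
by have := Aip (delta_mx i ord0) (delta_mx j ord0); rewrite /ip trmx_mul !mulmxA.
Qed.

Lemma Oplus_inverse A : Oplus A -> J *m A^T *m J *m A = 1%:M.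
Proof.
case=> /isometry_form AJ _; rewrite -!mulmxA mulmxA in AJ *.
by rewrite AJ minkowskiK.
Qed.

Lemma Oplus_unit A : Oplus A -> A \in unitmx.
Proof. by move=> /Oplus_inverse /mulmx1_unit[]. Qed.

Lemma Oplus_invmx A : Oplus A -> invmx A = J *m A^T *m J.
Proof.
move=> OA; rewrite -[RHS]mulmx1 -(mulmxV (Oplus_unit OA)) mulmxA.
by rewrite Oplus_inverse// mul1mx.
Qed.

Lemma Oplus1 : @Oplus R m 1%:M.
Proof. by split=> [v w|v]; rewrite !mul1mx. Qed.

Lemma Oplus_mul A B : Oplus A -> Oplus B -> Oplus (A *m B).
Proof.
move=> [Ai Ac] [Bi Bc]; split=> [v w|v Cv]; rewrite -!mulmxA ?Ai//.
exact/Ac/Bc.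
Qed.

Lemma mulmx_continuous (A B : 'M[R]_m.+1) :
  continuous (fun X : 'M[R]_m.+1 => A *m X *m B).
Proof.
move=> X; apply: differentiable_continuous.
apply: differentiable_mulmx; last exact: differentiable_cst.
by apply: differentiable_mulmx; [exact: differentiable_cst|exact: ex_diff].
Qed.

End Form.

(** The identity component is only known through connectedness; its stability under
    multiplication and conjugation comes from continuous maps preserving the group. *)
Lemma connected_component_image (T : topologicalType) (A : set T) (f : T -> T) x :
  continuous f -> (forall y, A y -> A (f y)) -> connected_component A x (f x) ->
  forall y, connected_component A x y -> connected_component A x (f y).
Proof.
move=> cf fA xfx y xy.
rewrite (same_connected_component xfx).
have sub : f @` connected_component A x `<=` connected_component A (f x).
  apply: connected_component_max.
  - exists x => //; apply: connected_component_refl.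
    by apply: contrapT => /connected_component_out E; rewrite E in xy.
  - by move=> _ [w /connected_component_sub Aw <-]; exact: fA.
  - apply: connected_continuous_connected; first exact: component_connected.
    exact: continuous_subspaceT.
by apply: sub; exists y.
Qed.

Section IdentityComponent.
Variable m : nat.
Implicit Types A B : 'M[R]_m.+1.

Lemma SOplus_Oplus A : SOplus A -> Oplus A.
Proof. exact: connected_component_sub. Qed.

Lemma SOplus1 : @SOplus R m 1%:M.
Proof. exact: connected_component_refl (Oplus1 m). Qed.

Lemma SOplus_mul A B : SOplus A -> SOplus B -> SOplus (A *m B).
Proof.
move=> SA; have OA := SOplus_Oplus SA.
apply: (@connected_component_image _ _ (fun X : 'M[R]_m.+1 => A *m X)).
- have -> : (fun X => A *m X) = (fun X : 'M[R]_m.+1 => A *m X *m 1%:M).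
    by apply/funext => X; rewrite mulmx1.
  exact: mulmx_continuous.
- by move=> X OX; exact: Oplus_mul.
- by rewrite mulmx1.
Qed.

Lemma SOplus_conj Q A : Oplus Q -> Q *m Q = 1%:M -> SOplus A -> SOplus (Q *m A *m Q).
Proof.
move=> OQ QQ.
apply: (@connected_component_image _ _ (fun X : 'M[R]_m.+1 => Q *m X *m Q)).
- exact: mulmx_continuous.
- by move=> X OX; apply: Oplus_mul => //; exact: Oplus_mul.
- by rewrite mulmx1 QQ; exact: SOplus1.
Qed.

End IdentityComponent.

Section Reflections.
Variable n : nat.
Implicit Types (g k Q A : 'M[R]_n.+4) (P : 'M[R]_n).

Definition block_diag (X : 'M[R]_4) (Y : 'M[R]_n) : 'M[R]_n.+4 :=
  (block_mx X 0 0 Y : 'M[R]_(4 + n)).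

Lemma block_diag_mul X Y X' Y' :
  block_diag X Y *m block_diag X' Y' = block_diag (X *m X') (Y *m Y').
Proof.
apply: etrans (@mulmx_block R 4 n 4 n 4 n X 0 0 Y X' 0 0 Y') _.
by rewrite !mul0mx !mulmx0 !addr0 !add0r.
Qed.

Lemma block_diag1 : block_diag 1%:M 1%:M = 1%:M.
Proof. by rewrite /block_diag -scalar_mx_block. Qed.

Lemma block_diag_tr X Y : (block_diag X Y)^T = block_diag X^T Y^T.
Proof. by apply: etrans (@tr_block_mx R 4 n 4 n X 0 0 Y) _; rewrite !trmx0. Qed.

Lemma block_diag_col X Y (u : 'cV[R]_4) :
  block_diag X Y *m (col_mx u 0 : 'cV[R]_(4 + n))
  = (col_mx (X *m u) 0 : 'cV[R]_(4 + n)).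
Proof.
apply: etrans (@mul_block_col R 4 n 4 n 1 X 0 0 Y u 0) _.
by rewrite !mul0mx !mulmx0 !addr0.
Qed.

Lemma diag_mx_block (d : 'I_n.+4 -> R) :
  diag_mx (\row_i d i) = block_diag (diag_mx (\row_i d (@lshift 4 n i)))
                                    (diag_mx (\row_i d (@rshift 4 n i))).
Proof.
apply: etrans _
  (@diag_mx_row R n 4 (\row_i d (@lshift 4 n i)) (\row_i d (@rshift 4 n i))).
congr diag_mx; apply/rowP => i; rewrite mxE.
by case: (@split_ordP 4 n i) => j ->; rewrite ?row_mxEl ?row_mxEr mxE.
Qed.

Lemma minkowski_block :
  Defs.minkowski R n.+3 = block_diag (Defs.minkowski R 3) 1%:M.
Proof.
rewrite /Defs.minkowski diag_mx_block -diag_const_mx.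
congr (block_diag (diag_mx _) (diag_mx _)).
by apply/rowP => i; rewrite !mxE.
Qed.

(** Both forms of the monodromy, with and without [Ptilde], are handled together by a
    matrix Q that is an orthogonal involution of the normal space and fixes
    Span(e_0, ..., e_3) pointwise; the instances are 1 and [Ptilde]. *)
Definition normal_reflection Q := exists P : 'M[R]_n,
  [/\ P^T = P, P *m P = 1%:M & Q = block_diag 1%:M P].

Lemma normal_reflection1 : normal_reflection 1%:M.
Proof. by exists 1%:M; rewrite trmx1 mulmx1 block_diag1. Qed.

Lemma normal_reflection_Ptilde : normal_reflection (Ptilde R n).
Proof.
exists (diag_mx (\row_i if val i == 0%N then -1 else 1)); split.
- exact: tr_diag_mx.
- rewrite mulmx_diag -diag_const_mx; congr diag_mx; apply/rowP => i.
  by rewrite !mxE; case: ifP => _; rewrite ?mulrNN mulr1.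
- rewrite /Ptilde diag_mx_block -diag_const_mx.
  congr (block_diag (diag_mx _) (diag_mx _)); apply/rowP => i; rewrite !mxE //=.
  by case: ifP => // /eqP i4; have := ltn_ord i; rewrite i4.
Qed.

Lemma reflectionK Q : normal_reflection Q -> Q *m Q = 1%:M.
Proof. by move=> [P [_ PP ->]]; rewrite block_diag_mul PP mulmx1 block_diag1. Qed.

Lemma reflection_col Q (u : 'cV[R]_4) : normal_reflection Q ->
  Q *m (col_mx u 0 : 'cV[R]_(4 + n)) = (col_mx u 0 : 'cV[R]_(4 + n)).
Proof. by move=> [P [_ _ ->]]; rewrite block_diag_col mul1mx. Qed.

Lemma reflection_Oplus Q : normal_reflection Q -> @Oplus R n.+3 Q.
Proof.
move=> [P [Pt PP ->]].
have iso : (block_diag 1%:M P)^T *m Defs.minkowski R n.+3 *m block_diag 1%:M P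
    = Defs.minkowski R n.+3.
  rewrite minkowski_block block_diag_tr !block_diag_mul trmx1 mul1mx mulmx1.
  by rewrite mulmx1 Pt PP.
split=> [|v [v0 vpos]]; first exact/isometry_form.
split; first by rewrite (isometry_form _).2.
suff -> : (block_diag 1%:M P *m v) ord0 ord0 = v ord0 ord0 by [].
have -> : block_diag 1%:M P *m v =
    (col_mx (@usubmx R 4 n 1 v) (P *m @dsubmx R 4 n 1 v) : 'cV_(4 + n)).
  rewrite -{1}(@vsubmxK R 4 n 1 v).
  apply: etrans (@mul_block_col R 4 n 4 n 1 _ 0 0 _ _ _) _.
  by rewrite !mul0mx mul1mx addr0 add0r.
have -> : (ord0 : 'I_n.+4) = @lshift 4 n ord0 by exact/val_inj.
by rewrite (@col_mxEu R 4 n 1) mxE.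
Qed.

Lemma reflection_G Q g : normal_reflection Q -> G g -> G (Q *m g *m Q).
Proof.
by move=> rQ; apply: SOplus_conj; [exact: reflection_Oplus|exact: reflectionK].
Qed.

Lemma reflection_K Q k : normal_reflection Q -> K k -> K (Q *m k *m Q).
Proof.
move=> [P [Pt PP ->]] [A SA [B [BB detB]] <-].
exists A => //; exists (P *m B *m P).
  split; last by rewrite !det_mulmx mulrAC -det_mulmx PP det1 mul1r.
  rewrite !trmx_mul Pt !mulmxA -(mulmxA (P *m B^T)) PP mulmx1.
  by rewrite -(mulmxA P) BB mulmx1 PP.
rewrite -[RHS]/(block_diag 1%:M P *m block_diag A B *m block_diag 1%:M P).
by rewrite !block_diag_mul mul1mx mulmx1.
Qed.

Lemma S0K : S0 R n *m S0 R n = 1%:M.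
Proof.
rewrite -[LHS]/(block_diag _ _ *m block_diag _ _) block_diag_mul.
by rewrite mulNmx mulmxN opprK !mulmx1 block_diag1.
Qed.

Lemma invmx_S0 : invmx (S0 R n) = S0 R n.
Proof.
have [uS _] := mulmx1_unit S0K.
by rewrite -[LHS]mulmx1 -S0K mulmxA mulVmx// mul1mx.
Qed.

Lemma reflection_S0 Q : normal_reflection Q -> Q *m S0 R n = S0 R n *m Q.
Proof.
move=> [P [_ _ ->]]; rewrite -[S0 R n]/(block_diag (- 1%:M) 1%:M) !block_diag_mul.
by rewrite !mul1mx !mulmx1.
Qed.

Lemma sigma_conj Q A : normal_reflection Q -> sigma (Q *m A *m Q) = Q *m sigma A *m Q.
Proof.
move=> rQ; rewrite /sigma invmx_S0 !mulmxA -(reflection_S0 rQ).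
by rewrite -!mulmxA (reflection_S0 rQ) !mulmxA.
Qed.

Lemma ppart_conj Q A : normal_reflection Q -> ppart (Q *m A *m Q) = Q *m ppart A *m Q.
Proof.
move=> rQ; rewrite /ppart sigma_conj// -mulmxBl -mulmxBr.
by rewrite -scalemxAr -scalemxAl.
Qed.

Lemma kpart_conj Q A : normal_reflection Q -> kpart (Q *m A *m Q) = Q *m kpart A *m Q.
Proof.
move=> rQ; rewrite /kpart sigma_conj// -mulmxDl -mulmxDr.
by rewrite -scalemxAr -scalemxAl.
Qed.

Lemma sigma_comb (a b : R) A B :
  sigma (a *: A + b *: B) = a *: sigma A + b *: sigma B.
Proof. by rewrite /sigma mulmxDr mulmxDl -!scalemxAr -!scalemxAl. Qed.

Lemma ppart_comb (a b : R) A B :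
  ppart (a *: A + b *: B) = a *: ppart A + b *: ppart B.
Proof.
by rewrite /ppart sigma_comb; apply/matrixP => i j; rewrite !mxE; ring.
Qed.

Lemma kpart_comb (a b : R) A B :
  kpart (a *: A + b *: B) = a *: kpart A + b *: kpart B.
Proof.
by rewrite /kpart sigma_comb; apply/matrixP => i j; rewrite !mxE; ring.
Qed.

Lemma K1 : @K R n 1%:M.
Proof.
exists 1%:M; first exact: SOplus1.
exists 1%:M; first by split; rewrite ?trmx1 ?mulmx1 ?det1.
exact: block_diag1.
Qed.

Lemma coset_refl g : coset g g.
Proof. by exists 1%:M; [exact: K1|rewrite mulmx1]. Qed.

(** Q normalises K, so multiplying by A on the left and Q on the right maps cosets of
    K to cosets of K. *)
Lemma coset_translate A Q g : normal_reflection Q ->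
  [set A *m x *m Q | x in coset g] = coset (A *m g *m Q).
Proof.
move=> rQ; apply/seteqP; split=> [_ [_ [k Kk <-] <-]|_ [k Kk <-]].
  exists (Q *m k *m Q); first exact: reflection_K.
  by rewrite !mulmxA -(mulmxA _ Q Q) reflectionK// mulmx1.
exists (g *m (Q *m k *m Q)).
  by exists (Q *m k *m Q) => //; exact: reflection_K.
by rewrite !mulmxA -(mulmxA _ Q Q) reflectionK// mulmx1.
Qed.

Lemma space_of_coset g :
  space_of (coset g)
  = [set g *m (col_mx u 0 : 'cV[R]_(4 + n)) | u in [set: 'cV[R]_4]].
Proof.
apply/seteqP; split=> [_ [_ [_ [A _ [B _ <-]] <-] [u _ <-]]|_ [u _ <-]].
  exists (A *m u) => //; rewrite -mulmxA; congr (_ *m _).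
  exact: esym (block_diag_col A B u).
by exists g; [exact: coset_refl|exists u].
Qed.

Lemma space_of_translate A Q g : normal_reflection Q ->
  space_of (coset (A *m g *m Q)) = [set A *m v | v in space_of (coset g)].
Proof.
move=> rQ; rewrite !space_of_coset image_comp; apply/seteqP.
have E u : A *m g *m Q *m (col_mx u 0 : 'cV[R]_(4 + n))
    = A *m (g *m (col_mx u 0 : 'cV[R]_(4 + n))).
  by rewrite -!mulmxA reflection_col.
by split=> _ [u _ <-]; exists u => //=; rewrite E.
Qed.

(** Whatever the sign of the determinant of A, the action on G/K induces the linear
    action of A on the represented 4-spaces, because [Ptilde] fixes
    Span(e_0, ..., e_3) pointwise. *)
Lemma space_of_act A g :
  space_of (act A (coset g)) = [set A *m v | v in space_of (coset g)].
Proof.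
rewrite space_of_coset image_comp /act; case: ifP => _; apply/seteqP; split.
- move=> _ [_ [_ [_ [X _ [Y _ <-]] <-] <-] [u _ <-]].
  exists (X *m u) => //=; rewrite -!mulmxA; congr (_ *m (_ *m _)).
  exact: esym (block_diag_col X Y u).
- move=> _ [u _ <-] /=; exists (A *m g); first by exists g => //; exact: coset_refl.
  by exists u => //; rewrite mulmxA.
- move=> _ [_ [_ [_ [X _ [Y _ <-]] <-] [_ [X' _ [Y' _ <-]] <-]] [u _ <-]].
  exists (X *m (X' *m u)) => //=; rewrite -!mulmxA; congr (_ *m (_ *m _)).
  rewrite [X in _ = _ *m (_ *m X)](block_diag_col X' Y' u).
  rewrite reflection_col; last exact: normal_reflection_Ptilde.
  exact: esym (block_diag_col X Y _).
- move=> _ [u _ <-] /=; exists (A *m g *m Ptilde R n *m 1%:M).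
    by exists g; [exact: coset_refl|exists 1%:M => //; exact: K1].
  exists u => //; rewrite mulmx1 -!mulmxA reflection_col//.
  exact: normal_reflection_Ptilde.
Qed.

Lemma monodromy_reflection (chi : R * R -> 'M[R]_n.+4) lam : circle lam ->
  monodromy_loop chi -> exists2 Q, normal_reflection Q & G (chi lam *m Q).
Proof.
move=> Clam [|] /connected_component_sub [_ /(_ _ Clam) Gchi _].
  by exists 1%:M; [exact: normal_reflection1|rewrite mulmx1].
by exists (Ptilde R n); [exact: normal_reflection_Ptilde|].
Qed.

End Reflections.
End LorentzGroup.

(** * Invariance of the conformal Gauss map *)

Section GaussSpace.
Context {R : realType}.
Variable n : nat.
Implicit Types (D U : set (R * R)) (W Y : R * R -> 'cV[R]_n.+4).

Definition lin_closed (S : set 'cV[R]_n.+4) :=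
  (forall v w, S v -> S w -> S (v + w)) /\ (forall (a : R) v, S v -> S (a *: v)).

Lemma gauss_space_lin_closed Y z : lin_closed (gauss_space Y z).
Proof.
rewrite /gauss_space; move: (Y z) (Re_dz Y z) (Im_dz Y z) (dzdzbar Y z) => v0 v1 v2 v3.
split=> [_ _ [a [b [c [d ->]]]] [a' [b' [c' [d' ->]]]]|t _ [a [b [c [d ->]]]]].
  exists (a + a'), (b + b'), (c + c'), (d + d').
  by apply/matrixP => i j; rewrite !mxE; ring.
exists (t * a), (t * b), (t * c), (t * d).
by apply/matrixP => i j; rewrite !mxE; ring.
Qed.

Lemma gauss_space_gen Y z :
  [/\ gauss_space Y z (Y z), gauss_space Y z (Re_dz Y z),
      gauss_space Y z (Im_dz Y z) & gauss_space Y z (dzdzbar Y z)].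
Proof.
split; [exists 1, 0, 0, 0|exists 0, 1, 0, 0|exists 0, 0, 1, 0|exists 0, 0, 0, 1];
by rewrite !scale0r scale1r ?addr0 ?add0r.
Qed.

Lemma gauss_space_sub Y z (S : set 'cV[R]_n.+4) : lin_closed S ->
  S (Y z) -> S (Re_dz Y z) -> S (Im_dz Y z) -> S (dzdzbar Y z) ->
  gauss_space Y z `<=` S.
Proof.
move=> [SD SZ] S0 S1 S2 S3 _ [a [b [c [d ->]]]].
by apply: (SD); [apply: (SD); [apply: (SD)|]|]; exact: SZ.
Qed.

(** The span depends only on the projectivised lift: the terms that the product rule
    adds to a derivative of s W are multiples of derivatives of W of lower order. *)
Lemma gauss_space_scale D (s : R * R -> R) W z : open D -> D z ->
  Ck_on 2 D s -> Ck_on 2 D W -> s z != 0 ->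
  gauss_space (fun w => s w *: W w) z = gauss_space W z.
Proof.
move=> oD Dz [ds [dsx _ _] [dsy _ _]] [dW [dWx _ _] [dWy _ _]] s0.
set V := fun w => _.
have Vx w : D w -> dx V w = s w *: dx W w + dx s w *: W w.
  by move=> Dw; exact: derive_scalemx (ds w Dw) (dW w Dw).
have Vy w : D w -> dy V w = s w *: dy W w + dy s w *: W w.
  by move=> Dw; exact: derive_scalemx (ds w Dw) (dW w Dw).
have Vxx : dx (dx V) z = s z *: dx (dx W) z + dx s z *: dx W z
    + (dx s z *: dx W z + dx (dx s) z *: W z).
  rewrite (dx_congr oD Dz Vx).
  have d1 := differentiable_scalemx (ds z Dz) (dWx z Dz).
  have d2 := differentiable_scalemx (dsx z Dz) (dW z Dz).
  apply: etrans (deriveD (diff_derivable d1) (diff_derivable d2)) _.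
  apply: congr2; first exact: derive_scalemx (ds z Dz) (dWx z Dz).
  exact: derive_scalemx (dsx z Dz) (dW z Dz).
have Vyy : dy (dy V) z = s z *: dy (dy W) z + dy s z *: dy W z
    + (dy s z *: dy W z + dy (dy s) z *: W z).
  rewrite (dy_congr oD Dz Vy).
  have d1 := differentiable_scalemx (ds z Dz) (dWy z Dz).
  have d2 := differentiable_scalemx (dsy z Dz) (dW z Dz).
  apply: etrans (deriveD (diff_derivable d1) (diff_derivable d2)) _.
  apply: congr2; first exact: derive_scalemx (ds z Dz) (dWy z Dz).
  exact: derive_scalemx (dsy z Dz) (dW z Dz).
have V1 : Re_dz V z = s z *: Re_dz W z + (2^-1 * dx s z) *: W z.
  rewrite /Re_dz (Vx z Dz); move: (dx W z) (W z) (s z) (dx s z) => a b c d.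
  by apply/matrixP => i j; rewrite !mxE; ring.
have V2 : Im_dz V z = s z *: Im_dz W z + (- 2^-1 * dy s z) *: W z.
  rewrite /Im_dz (Vy z Dz); move: (dy W z) (W z) (s z) (dy s z) => a b c d.
  by apply/matrixP => i j; rewrite !mxE; ring.
have V3 : dzdzbar V z = s z *: dzdzbar W z
    + ((dx s z *: Re_dz W z + (- dy s z) *: Im_dz W z)
    + (4^-1 * (dx (dx s) z + dy (dy s) z)) *: W z).
  rewrite /dzdzbar /Re_dz /Im_dz Vxx Vyy.
  move: (dx W z) (dy W z) (W z) (dx (dx W) z) (dy (dy W) z).
  move: (s z) (dx s z) (dy s z) (dx (dx s) z) (dy (dy s) z).
  move=> a b c d e f g i j k.
  by apply/matrixP => i' j'; rewrite !mxE; field.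
have [W0g W1g W2g W3g] := gauss_space_gen W z.
have [V0g V1g V2g V3g] := gauss_space_gen V z.
have [WD WZ] := gauss_space_lin_closed W z.
have [VD VZ] := gauss_space_lin_closed V z.
have W0E : W z = (s z)^-1 *: V z by rewrite scalerA mulVf// scale1r.
have inv (v w x : 'cV[R]_n.+4) :
    w = s z *: v + x -> v = (s z)^-1 *: (w + (-1) *: x).
  by move=> ->; rewrite scaleN1r addrK scalerA mulVf// scale1r.
have W0V : gauss_space V z (W z) by rewrite W0E; exact: VZ.
have W1V : gauss_space V z (Re_dz W z).
  by rewrite (inv _ _ _ V1); apply: (VZ); apply: (VD); [exact: V1g|do 2!apply: (VZ)].
have W2V : gauss_space V z (Im_dz W z).
  by rewrite (inv _ _ _ V2); apply: (VZ); apply: (VD); [exact: V2g|do 2!apply: (VZ)].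
apply/seteqP; split; apply: gauss_space_sub.
- exact: gauss_space_lin_closed.
- exact: WZ W0g.
- by rewrite V1; apply: (WD); [exact: WZ W1g|exact: WZ W0g].
- by rewrite V2; apply: (WD); [exact: WZ W2g|exact: WZ W0g].
- rewrite V3; apply: (WD); first exact: WZ W3g.
  apply: (WD); last exact: WZ W0g.
  by apply: (WD); [exact: WZ W1g|exact: WZ W2g].
- exact: gauss_space_lin_closed.
- exact: W0V.
- exact: W1V.
- exact: W2V.
- rewrite (inv _ _ _ V3); apply: (VZ); apply: (VD); first exact: V3g.
  apply: (VZ); apply: (VD); last exact: VZ W0V.
  by apply: (VD); [exact: VZ W1V|exact: VZ W2V].
Qed.

Lemma gauss_space_mul D (A : 'M[R]_n.+4) Y z : open D -> D z -> Ck_on 2 D Y ->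
  gauss_space (fun w => A *m Y w) z = [set A *m v | v in gauss_space Y z].
Proof.
move=> oD Dz [dY [dYx _ _] [dYy _ _]].
have mulA (v : R * R) (f : R * R -> 'cV[R]_n.+4) w : differentiable f w ->
    'D_v (fun w => A *m f w) w = A *m 'D_v f w.
  move=> df; rewrite (derive_mulmx v (differentiable_cst A w) df).
  by rewrite derive_cst mul0mx add0r.
have Ax w : D w -> dx (fun w => A *m Y w) w = A *m dx Y w.
  by move=> Dw; exact: mulA (dY w Dw).
have Ay w : D w -> dy (fun w => A *m Y w) w = A *m dy Y w.
  by move=> Dw; exact: mulA (dY w Dw).
have Axx : dx (dx (fun w => A *m Y w)) z = A *m dx (dx Y) z.
  by rewrite (dx_congr oD Dz Ax); exact: mulA (dYx z Dz).
have Ayy : dy (dy (fun w => A *m Y w)) z = A *m dy (dy Y) z.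
  by rewrite (dy_congr oD Dz Ay); exact: mulA (dYy z Dz).
have E1 : Re_dz (fun w => A *m Y w) z = A *m Re_dz Y z.
  by rewrite /Re_dz (Ax z Dz) -scalemxAr.
have E2 : Im_dz (fun w => A *m Y w) z = A *m Im_dz Y z.
  by rewrite /Im_dz (Ay z Dz) mulmxN -scalemxAr.
have E3 : dzdzbar (fun w => A *m Y w) z = A *m dzdzbar Y z.
  by rewrite /dzdzbar Axx Ayy -mulmxDr -scalemxAr.
rewrite /gauss_space E1 E2 E3.
move: (Re_dz Y z) (Im_dz Y z) (dzdzbar Y z) (Y z) => v1 v2 v3 v0.
have AE (a b c d : R) :
    a *: (A *m v0) + b *: (A *m v1) + c *: (A *m v2) + d *: (A *m v3)
    = A *m (a *: v0 + b *: v1 + c *: v2 + d *: v3).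
  by rewrite !mulmxDr -!scalemxAr.
apply/seteqP; split=> [_ [a [b [c [d ->]]]]|_ [_ [a [b [c [d ->]]]] <-]].
  by exists (a *: v0 + b *: v1 + c *: v2 + d *: v3); [exists a, b, c, d|rewrite AE].
by exists a, b, c, d; rewrite AE.
Qed.

(** A holomorphic change of the parameter rotates and scales the pair (Re Y_z, Im Y_z)
    and scales the mixed derivative. *)
Lemma gauss_space_comp D U (h : R * R -> R * R) Y z :
  open D -> holomorphic_on D h -> open U -> (forall w, D w -> U (h w)) ->
  Ck_on 2 U Y -> D z -> 0 < conformal_factor h z ->
  gauss_space (fun w => Y (h w)) z = gauss_space Y (h z).
Proof.
move=> oD hol oU hU CY Dz; have [dY _ _] := CY.
have dYz := dY _ (hU z Dz).
have E1 : Re_dz (fun w => Y (h w)) z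
    = re_deriv h z *: Re_dz Y (h z) + (- im_deriv h z) *: Im_dz Y (h z).
  rewrite /Re_dz /Im_dz (dx_comp hol Dz dYz).
  move: (dx Y _) (dy Y _) (re_deriv h z) (im_deriv h z) => v w s t.
  by apply/matrixP => i j; rewrite !mxE; ring.
have E2 : Im_dz (fun w => Y (h w)) z
    = im_deriv h z *: Re_dz Y (h z) + re_deriv h z *: Im_dz Y (h z).
  rewrite /Re_dz /Im_dz (dy_comp hol Dz dYz).
  move: (dx Y _) (dy Y _) (re_deriv h z) (im_deriv h z) => v w s t.
  by apply/matrixP => i j; rewrite !mxE; ring.
have E3 := dzdzbar_comp oD hol oU hU CY Dz.
have [[HD HZ] [G0 G1 G2 G3]] :=
  (gauss_space_lin_closed Y (h z), gauss_space_gen Y (h z)).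
have [[VD VZ] [V0 V1 V2 V3]] :=
  (gauss_space_lin_closed (fun w => Y (h w)) z, gauss_space_gen (fun w => Y (h w)) z).
rewrite /conformal_factor; move: E1 E2 E3; rewrite /conformal_factor.
set p := re_deriv h z; set q := im_deriv h z; move=> E1 E2 E3 m0.
have mN : p ^+ 2 + q ^+ 2 != 0 by rewrite gt_eqF.
have F1 : Re_dz Y (h z) = ((p ^+ 2 + q ^+ 2)^-1 * p) *: Re_dz (fun w => Y (h w)) z
    + ((p ^+ 2 + q ^+ 2)^-1 * q) *: Im_dz (fun w => Y (h w)) z.
  rewrite E1 E2; move: (Re_dz Y _) (Im_dz Y _) (p) (q) mN => v w s t mN.
  by apply/matrixP => i j; rewrite !mxE; field.
have F2 : Im_dz Y (h z) = ((p ^+ 2 + q ^+ 2)^-1 * - q) *: Re_dz (fun w => Y (h w)) z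
    + ((p ^+ 2 + q ^+ 2)^-1 * p) *: Im_dz (fun w => Y (h w)) z.
  rewrite E1 E2; move: (Re_dz Y _) (Im_dz Y _) (p) (q) mN => v w s t mN.
  by apply/matrixP => i j; rewrite !mxE; field.
have F3 : dzdzbar Y (h z) = (p ^+ 2 + q ^+ 2)^-1 *: dzdzbar (fun w => Y (h w)) z.
  by rewrite E3 scalerA mulVf// scale1r.
apply/seteqP; split; apply: gauss_space_sub.
- exact: gauss_space_lin_closed.
- exact: G0.
- by rewrite E1; apply: (HD); [exact: HZ G1|exact: HZ G2].
- by rewrite E2; apply: (HD); [exact: HZ G1|exact: HZ G2].
- by rewrite E3; exact: HZ G3.
- exact: gauss_space_lin_closed.
- exact: V0.
- by rewrite F1; apply: (VD); [exact: VZ V1|exact: VZ V2].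
- by rewrite F2; apply: (VD); [exact: VZ V1|exact: VZ V2].
- by rewrite F3; exact: VZ V3.
Qed.

End GaussSpace.

(** * Spheres and light cones *)

Section LightCone.
Context {R : realType}.
Variable m : nat.
Implicit Types (v : 'cV[R]_m.+1) (y : 'cV[R]_m) (A : 'M[R]_m.+1).

(** For y on the unit sphere, the point of the light cone over y of height one. *)
Definition light_lift y : 'cV[R]_m.+1 :=
  \col_i (if unlift ord0 i is Some j then y j ord0 else 1).

(** The action of O^+(1, m) on the sphere as the projectivised light cone. *)
Definition moebius A y : 'cV[R]_m := sphere_point (A *m light_lift y).

Lemma light_lift0 y : light_lift y ord0 ord0 = 1.
Proof. by rewrite mxE unlift_none. Qed.

Lemma light_liftS y i : light_lift y (lift ord0 i) ord0 = y i ord0.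
Proof. by rewrite mxE liftK. Qed.

Lemma dotE y y' : dot y y' = \sum_i y i ord0 * y' i ord0.
Proof. by rewrite /dot mxE; apply: eq_bigr => i _; rewrite mxE. Qed.

Lemma ip_light_lift y y' : ip (light_lift y) (light_lift y') = dot y y' - 1.
Proof.
rewrite ipE !light_lift0 mulr1 addrC dotE; congr (_ - _).
by apply: eq_bigr => i _; rewrite !light_liftS.
Qed.

Lemma light_lift_sphere_point v : v ord0 ord0 != 0 ->
  v = v ord0 ord0 *: light_lift (sphere_point v).
Proof.
move=> v0; apply/colP => i; rewrite mxE.
case: (unliftP ord0 i) => [j|] ->; last by rewrite light_lift0 mulr1.
by rewrite light_liftS mxE mulrC divfK.
Qed.

Lemma sphere_point_scale (c : R) v : c != 0 ->
  sphere_point (c *: v) = sphere_point v.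
Proof. by move=> c0; apply/colP => i; rewrite !mxE -mulf_div divff// mul1r. Qed.

Lemma sphere_point_mul A v : v ord0 ord0 != 0 ->
  sphere_point (A *m v) = moebius A (sphere_point v).
Proof.
by move=> v0; rewrite {1}(light_lift_sphere_point v0) -scalemxAr sphere_point_scale.
Qed.

Lemma forward_cone_neq0 v : forward_cone v -> v ord0 ord0 != 0.
Proof. by case=> _; rewrite /= lt_def => /andP[]. Qed.

Lemma forward_coneZ (c : R) v : 0 < c -> forward_cone v -> forward_cone (c *: v).
Proof.
move=> c0 [v0 vpos]; split; first by rewrite ipZl ipZr v0 !mulr0.
by rewrite mxE mulr_gt0.
Qed.

(** A lift and its projection to the sphere induce the same metric up to the square of
    the height s: differentiating s contributes multiples of the light-like vector
    itself, which is orthogonal to itself and to the derivatives of the lift. *)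
Lemma ip_derive_lift (D : set (R * R)) (s : R * R -> R) (y : R * R -> 'cV[R]_m)
    (Y : R * R -> 'cV[R]_m.+1) z (a b : R * R) :
  open D -> D z -> differentiable s z -> (forall p, D p -> differentiable y p) ->
  (forall p, D p -> dot (y p) (y p) = 1) ->
  (forall p, D p -> Y p = s p *: light_lift (y p)) ->
  ip ('D_a Y z) ('D_b Y z) = s z ^+ 2 * dot ('D_a y z) ('D_b y z).
Proof.
move=> oD Dz ds dy1 ysph YE; have dyz := dy1 z Dz.
pose tangent (x : 'cV[R]_m) : 'cV[R]_m.+1 :=
  \col_i (if unlift ord0 i is Some j then x j ord0 else 0).
have dL : differentiable (fun p => light_lift (y p)) z.
  apply: differentiable_mx => i j; rewrite (ord1 j).
  case: (unliftP ord0 i) => [k|] ->.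
    have -> : (fun w => light_lift (y w) (lift ord0 k) ord0) = (fun w => y w k ord0).
      by apply/funext => w; rewrite light_liftS.
    exact: differentiable_entry.
  have -> : (fun w => light_lift (y w) ord0 ord0) = cst 1.
    by apply/funext => w; rewrite light_lift0.
  exact: differentiable_cst.
have DL c : 'D_c (fun p => light_lift (y p)) z = tangent ('D_c y z).
  apply: derive_mx_eq => // i j; rewrite (ord1 j) mxE.
  case: (unliftP ord0 i) => [k|] ->.
    have -> : (fun w => light_lift (y w) (lift ord0 k) ord0) = (fun w => y w k ord0).
      by apply/funext => w; rewrite light_liftS.
    by rewrite -derive_entry.
  have -> : (fun w => light_lift (y w) ord0 ord0) = cst 1.
    by apply/funext => w; rewrite light_lift0.
  exact: derive_cst.
have DY c : 'D_c Y z = s z *: tangent ('D_c y z) + 'D_c s z *: light_lift (y z).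
  by rewrite (derive_congr c oD Dz YE) (derive_scalemx c ds dL) DL.
have tt x x' : ip (tangent x) (tangent x') = dot x x'.
  rewrite ipE !mxE unlift_none mul0r oppr0 add0r dotE.
  by apply: eq_bigr => i _; rewrite !mxE liftK.
have tl x : ip (tangent x) (light_lift (y z)) = dot x (y z).
  rewrite ipE !mxE unlift_none mul0r oppr0 add0r dotE.
  by apply: eq_bigr => i _; rewrite !mxE liftK.
have ll : ip (light_lift (y z)) (light_lift (y z)) = 0.
  by rewrite ip_light_lift ysph// subrr.
(* Differentiate dot y y = 1. *)
have dotD c : dot ('D_c y z) (y z) = 0.
  have dyt : differentiable (fun p => (y p)^T) z.
    apply: differentiable_mx => i j.
    have -> : (fun w => (y w)^T i j) = (fun w => y w j i).
      by apply/funext => w; rewrite mxE.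
    exact: differentiable_entry.
  have Dyt : 'D_c (fun p => (y p)^T) z = ('D_c y z)^T.
    apply: derive_mx_eq => // i j.
    have -> : (fun w => (y w)^T i j) = (fun w => y w j i).
      by apply/funext => w; rewrite mxE.
    by rewrite mxE derive_entry.
  have := derive_mulmx c dyt dyz; rewrite Dyt.
  have yc p : D p -> (y p)^T *m y p = 1%:M.
    by move=> Dp; apply/matrixP => i j; rewrite !ord1 [RHS]mxE eqxx; exact: ysph.
  rewrite (derive_congr c oD Dz yc) derive_cst => /matrixP /(_ ord0 ord0).
  rewrite mxE [RHS]mxE -!/(dot _ _) !dotE => E.
  have {}E : 0 = \sum_i ('D_c y z) i ord0 * y z i ord0 *+ 2.
    apply: etrans E _; rewrite -big_split; apply: eq_bigr => i _.
    by rewrite mulr2n [y z i ord0 * _]mulrC.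
  move/eqP: E; rewrite eq_sym sumrMnl mulrn_eq0 /= => /eqP //.
rewrite !DY; move: (dotD a) (dotD b) tl ll {DY}.
move: ('D_a y z) ('D_b y z) ('D_a s z) ('D_b s z) (light_lift _) (s z).
move=> u v c d l t.
move=> uy vy tl ll; rewrite ipDl !ipDr !ipZl !ipZr tt ll tl ipC tl uy vy.
by rewrite !mulr0 !addr0 mulrA expr2.
Qed.

End LightCone.

(** * The image of a surface under a Moebius transformation and a reparametrisation *)

Section TransformedSurface.
Context {R : realType}.
Variables (n : nat) (D : set (R * R)).
Hypothesis oD : open D.

Lemma wirtinger_energy m (Y : R * R -> 'cV[R]_m.+1) z :
  ip (Re_dz Y z) (Re_dz Y z) + ip (Im_dz Y z) (Im_dz Y z)
  = 4^-1 * (ip (dx Y z) (dx Y z) + ip (dy Y z) (dy Y z)).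
Proof.
rewrite /Re_dz /Im_dz; move: (dx Y z) (dy Y z) => a b.
by rewrite -scaleNr !ipZl !ipZr; field.
Qed.

(** The normalisation of the canonical lift only fixes the trace of its metric;
    conformality of y makes the metric a multiple of the flat one. *)
Lemma canonical_lift_metric (y : R * R -> 'cV[R]_n.+3)
    (Y : R * R -> 'cV[R]_n.+4) (z : R * R) :
  conformal_immersion D y -> canonical_lift D y Y -> D z ->
  [/\ ip (dx Y z) (dx Y z) = 1, ip (dy Y z) (dy Y z) = 1 & ip (dx Y z) (dy Y z) = 0].
Proof.
move=> [sy ysurf] [sY Ylift] Dz.
have [_ xx_yy xy _] := ysurf z Dz; have [_ _] := Ylift z Dz.
have [dY _ _] := sY 1%N; have [dy1 _ _] := sy 1%N.
have lift a b := @ip_derive_lift R _ D (fun p => Y p ord0 ord0) y Y z a b oD Dz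
  (differentiable_entry ord0 ord0 (dY z Dz)) dy1.
have {}lift a b : ip ('D_a Y z) ('D_b Y z)
    = Y z ord0 ord0 ^+ 2 * dot ('D_a y z) ('D_b y z).
  apply: lift => p Dp; first by have [] := ysurf p Dp.
  have [cone <- _] := Ylift p Dp.
  by apply: light_lift_sphere_point; exact: forward_cone_neq0.
have lxx : ip (dx Y z) (dx Y z) = ip (dy Y z) (dy Y z).
  exact: etrans (lift _ _) (etrans (congr1 _ xx_yy) (esym (lift _ _))).
have lxy : ip (dx Y z) (dy Y z) = 0.
  exact: etrans (lift _ _) (etrans (congr1 _ xy) (mulr0 _)).
move=> /(etrans (esym (wirtinger_energy Y z))) E; rewrite lxx in E.
have lyy : ip (dy Y z) (dy Y z) = 1.
  move: (ip (dy Y z) (dy Y z)) E => t E; clear -E; lra.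
by split; [exact: etrans lxx lyy|exact: lyy|exact: lxy].
Qed.

Variables (h g : R * R -> R * R).
Hypotheses (hol : holomorphic_on D h) (hD : forall z, D z -> D (h z))
  (dg : forall z, D z -> differentiable g z) (gK : forall z, D z -> g (h z) = z).

Let factor_gt0 z : D z -> 0 < conformal_factor h z.
Proof. by move=> Dz; apply: (conformal_factor_gt0 oD hol Dz _ gK); exact/dg/hD. Qed.

Lemma smooth_conformal_factor : smooth_on D (conformal_factor h).
Proof.
move=> k; have Cp := smooth_re_deriv oD hol k.
have Cq := smooth_im_deriv oD hol k.
exact: (CkD oD (CkM oD Cp Cp) (CkM oD Cq Cq)).
Qed.

Let smooth_rescaling :
  smooth_on D (fun z => (Num.sqrt (conformal_factor h z))^-1).
Proof.
move=> k; apply: (CkV oD) => [z Dz|].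
  by rewrite sqrtr_eq0 -ltNge; exact: factor_gt0.
by apply: (Ck_sqrt oD factor_gt0); exact: smooth_conformal_factor.
Qed.

Variable A : 'M[R]_n.+4.
Hypothesis OA : @Oplus R n.+3 A.
Variables (y : R * R -> 'cV[R]_n.+3) (Y : R * R -> 'cV[R]_n.+4).
Hypotheses (ysurf : conformal_immersion D y) (Ylift : canonical_lift D y Y).

Definition transformed_surface (z : R * R) := moebius A (y (h z)).
(** The image lift, divided by |h'| to restore the normalisation of the metric. *)
Definition transformed_lift (z : R * R) :=
  (Num.sqrt (conformal_factor h z))^-1 *: (A *m Y (h z)).

Local Notation W := (fun z => A *m Y (h z)).

Let smooth_W : smooth_on D W.
Proof.
move=> k; apply: (Ck_mulmx oD); first exact: Ck_cst.
exact: (Ck_mx_comp oD oD hD (hol.1 k) (Ylift.1 k)).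
Qed.

Let cone_W z : D z -> forward_cone (W z).
Proof. by move=> Dz; apply: OA.2; have [] := Ylift.2 _ (hD Dz). Qed.

Let W_neq0 z : D z -> W z ord0 ord0 != 0.
Proof. by move=> Dz; apply: forward_cone_neq0; exact: cone_W. Qed.

Let sphere_W z : D z -> sphere_point (W z) = transformed_surface z.
Proof.
move=> Dz; rewrite /transformed_surface; have [cY <- _] := Ylift.2 _ (hD Dz).
by rewrite sphere_point_mul//; exact: forward_cone_neq0.
Qed.

Let WE z : D z -> W z = W z ord0 ord0 *: light_lift (transformed_surface z).
Proof.
by move=> Dz; rewrite -sphere_W//; apply: light_lift_sphere_point; exact: W_neq0.
Qed.

Lemma smooth_transformed_surface : smooth_on D transformed_surface.
Proof.
move=> k; apply: (Ck_congr oD sphere_W); apply: (Ck_mx oD) => i j.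
have C := CkM oD (Ck_entry (lift ord0 i) ord0 oD (@smooth_W k))
  (CkV oD W_neq0 (Ck_entry ord0 ord0 oD (@smooth_W k))).
by apply: Ck_congr oD _ C => z _; rewrite [RHS]mxE.
Qed.

Let sphere_transformed z : D z -> dot (transformed_surface z) (transformed_surface z) = 1.
Proof.
move=> Dz; have [Wnull _] := cone_W Dz.
move: Wnull; rewrite (WE Dz) ipZl ipZr ip_light_lift => /eqP.
rewrite !mulf_eq0 (negPf (W_neq0 Dz)) /= subr_eq0 => /eqP //.
Qed.

Let metric_W z : D z ->
  [/\ ip (dx W z) (dx W z) = conformal_factor h z,
      ip (dy W z) (dy W z) = conformal_factor h z & ip (dx W z) (dy W z) = 0].
Proof.
move=> Dz; have [xx yy xy] := canonical_lift_metric ysurf Ylift (hD Dz).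
have [dY _ _] := Ylift.1 1%N; have dYz := dY _ (hD Dz).
have dYh : differentiable (fun w => Y (h w)) z.
  by apply: differentiable_comp => //; exact: (hol_differentiable hol).
have DA v : 'D_v W z = A *m 'D_v (fun w => Y (h w)) z.
  rewrite (derive_mulmx v (differentiable_cst A z) dYh).
  by rewrite derive_cst mul0mx add0r.
have Wx : dx W z = A *m (re_deriv h z *: dx Y (h z) + im_deriv h z *: dy Y (h z)).
  by rewrite -(dx_comp hol Dz dYz); exact: DA.
have Wy : dy W z = A *m (- im_deriv h z *: dx Y (h z) + re_deriv h z *: dy Y (h z)).
  by rewrite -(dy_comp hol Dz dYz); exact: DA.
rewrite Wx Wy !OA.1 /conformal_factor.
move: (dx Y _) (dy Y _) (re_deriv h z) (im_deriv h z) xx yy xy => a b p q aa bb ab.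
by rewrite !ipDl !ipDr !ipZl !ipZr aa bb (ipC b) ab; split; ring.
Qed.

(** [ip_derive_lift] for all multiples s W of the image lift at once: s = 1 gives
    conformality of the transformed surface, s = 1 / |h'| the normalisation of its
    canonical lift. *)
Let derive_lift_W (s : R * R -> R) z a b : D z -> differentiable s z ->
  ip ('D_a (fun w => s w *: W w) z) ('D_b (fun w => s w *: W w) z)
  = (s z * W z ord0 ord0) ^+ 2
    * dot ('D_a transformed_surface z) ('D_b transformed_surface z).
Proof.
move=> Dz ds; have [dW _ _] := smooth_W 1%N.
have [dy1 _ _] := smooth_transformed_surface 1%N.
apply: (@ip_derive_lift R _ D (fun p => s p * W p ord0 ord0) _ _ z a b oD Dz _ dy1).
- by apply: differentiableM => //; exact: (differentiable_entry ord0 ord0 (dW z Dz)).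
- exact: sphere_transformed.
- by move=> p Dp; rewrite {1}(WE Dp) scalerA.
Qed.

Let metric_transformed z : D z ->
  [/\ W z ord0 ord0 ^+ 2
        * dot (dx transformed_surface z) (dx transformed_surface z)
        = conformal_factor h z,
      W z ord0 ord0 ^+ 2
        * dot (dy transformed_surface z) (dy transformed_surface z)
        = conformal_factor h z
    & W z ord0 ord0 ^+ 2
        * dot (dx transformed_surface z) (dy transformed_surface z) = 0].
Proof.
move=> Dz; have [xx yy xy] := metric_W Dz.
have E a b : W z ord0 ord0 ^+ 2
      * dot ('D_a transformed_surface z) ('D_b transformed_surface z)
    = ip ('D_a W z) ('D_b W z).
  have := derive_lift_W a b Dz (differentiable_cst (1 : R) z).
  rewrite /cst mul1r => <-.
  have W1 w : D w -> 1 *: W w = W w by rewrite scale1r.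
  by rewrite (derive_congr a oD Dz W1) (derive_congr b oD Dz W1).
by split; [exact: etrans (E _ _) xx|exact: etrans (E _ _) yy|
           exact: etrans (E _ _) xy].
Qed.

Lemma transformed_immersion : conformal_immersion D transformed_surface.
Proof.
split=> [|z Dz]; first exact: smooth_transformed_surface.
have [xx yy xy] := metric_transformed Dz.
have t0 : 0 < W z ord0 ord0 ^+ 2 by rewrite exprn_even_gt0//= W_neq0.
have tN : W z ord0 ord0 ^+ 2 != 0 by rewrite gt_eqF.
split.
- exact: sphere_transformed.
- exact: mulfI tN _ _ (etrans xx (esym yy)).
- exact: mulfI tN _ _ (etrans xy (esym (mulr0 _))).
- have := factor_gt0 Dz; rewrite -xx.
  by move: (dot _ _) (_ ^+ 2) t0 => c t t0; rewrite pmulr_rgt0.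
Qed.

Lemma canonical_transformed_lift :
  canonical_lift D transformed_surface transformed_lift.
Proof.
split=> [k|z Dz]; first exact: (CkZ oD (smooth_rescaling k) (smooth_W k)).
have f0 := factor_gt0 Dz.
have s0 : 0 < (Num.sqrt (conformal_factor h z))^-1 by rewrite invr_gt0 sqrtr_gt0.
have [ds _ _] := smooth_rescaling 1%N.
split.
- by apply: forward_coneZ => //; exact: cone_W.
- by rewrite sphere_point_scale ?gt_eqF//; exact: sphere_W.
- have [xx yy xy] := metric_transformed Dz.
  have E a b : ip ('D_a transformed_lift z) ('D_b transformed_lift z) =
      (conformal_factor h z)^-1 * (W z ord0 ord0 ^+ 2 *
        dot ('D_a transformed_surface z) ('D_b transformed_surface z)).
    rewrite [LHS](derive_lift_W a b Dz (ds z Dz)) exprMn exprVn sqr_sqrtr ?ltW//.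
    exact: esym (mulrA _ _ _).
  have Exx : ip (dx transformed_lift z) (dx transformed_lift z) = 1.
    by rewrite [LHS]E [X in _ * X]xx mulVf// gt_eqF.
  have Eyy : ip (dy transformed_lift z) (dy transformed_lift z) = 1.
    by rewrite [LHS]E [X in _ * X]yy mulVf// gt_eqF.
  have energy (s t : R) : s = 1 -> t = 1 -> 4^-1 * (s + t) = 2^-1.
    by move=> -> ->; field.
  have E1 := energy _ _ Exx Eyy.
  have E2 := wirtinger_energy transformed_lift z.
  exact: etrans E2 E1.
Qed.

Lemma gauss_space_transformed z : D z ->
  gauss_space transformed_lift z = [set A *m v | v in gauss_space Y (h z)].
Proof.
move=> Dz.
rewrite (gauss_space_scale oD Dz (smooth_rescaling 2) (smooth_W 2)); last first.
  by rewrite invr_eq0 sqrtr_eq0 -ltNge; exact: factor_gt0.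
have CYh := Ck_mx_comp oD oD hD (hol.1 2) (Ylift.1 2).
rewrite (gauss_space_mul A oD Dz CYh).
by rewrite (gauss_space_comp oD hol oD hD (Ylift.1 2) Dz (factor_gt0 Dz)).
Qed.

End TransformedSurface.

(** * The tension field under translations and conformal reparametrisations *)

Section HarmonicTranslate.
Context {R : realType}.
Variable n : nat.
Implicit Types (D U : set (R * R)).

Lemma invmx_eq m (M B : 'M[R]_m) : B *m M = 1%:M -> invmx M = B.
Proof.
move=> BM; have [_ uM] := mulmx1_unit BM.
by rewrite -[LHS]mul1mx -BM -mulmxA mulmxV// mulmx1.
Qed.

Lemma Ck_ppart k D (X : R * R -> 'M[R]_n.+4) : open D ->
  Ck_on k D X -> Ck_on k D (fun z => ppart (X z)).
Proof.
move=> oD CX.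
have C := CkZ oD (Ck_cst k D (2^-1 : R)) (CkD oD CX
  (CkZ oD (Ck_cst k D (-1 : R)) (Ck_mulmx oD (Ck_mulmx oD (Ck_cst k D (S0 R n)) CX)
    (Ck_cst k D (invmx (S0 R n)))))).
by apply: Ck_congr oD _ C => z _; rewrite /cst scaleN1r.
Qed.

(** On the Lorentz group inversion is X |-> J X^T J, hence linear in the entries. *)
Lemma Ck_invmx k U (F : R * R -> 'M[R]_n.+4) : open U ->
  (forall z, U z -> G (F z)) -> Ck_on k U F -> Ck_on k U (fun z => invmx (F z)).
Proof.
move=> oU GF CF.
have CJ := Ck_cst k U (Defs.minkowski R n.+3).
have C := Ck_mulmx oU (Ck_mulmx oU CJ (Ck_trmx oU CF)) CJ.
apply: Ck_congr oU _ C => z Uz; apply: esym; apply: Oplus_invmx.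
exact: SOplus_Oplus (GF z Uz).
Qed.

Lemma bracket_conj (Q X Y : 'M[R]_n.+4) : Q *m Q = 1%:M ->
  bracket (Q *m X *m Q) (Q *m Y *m Q) = Q *m bracket X Y *m Q.
Proof.
move=> QQ; have E X' Y' : Q *m X' *m Q *m (Q *m Y' *m Q) = Q *m (X' *m Y') *m Q.
  by rewrite !mulmxA -(mulmxA _ Q Q) QQ mulmx1.
by rewrite /bracket !E -mulmxBl -mulmxBr.
Qed.

Lemma bracket_rotate (p q : R) (a b c d : 'M[R]_n.+4) :
  bracket (p *: a + q *: b) (p *: c + q *: d)
  + bracket (- q *: a + p *: b) (- q *: c + p *: d)
  = (p ^+ 2 + q ^+ 2) *: (bracket a c + bracket b d).
Proof.
rewrite /bracket !(mulmxDl, mulmxDr) -!(scalemxAl, scalemxAr) !scalerA.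
move: (a *m c) (c *m a) (b *m d) (d *m b) (a *m d) (d *m a) (b *m c) (c *m b).
by move=> *; apply/matrixP => i j; rewrite !mxE; ring.
Qed.

Lemma mulmx_comb (M X Y : 'M[R]_n.+4) (s t : R) :
  M *m (s *: X + t *: Y) = s *: (M *m X) + t *: (M *m Y).
Proof. by rewrite mulmxDr -!scalemxAr. Qed.

(** Collects the two divergence terms and the two bracket terms of the tension. *)
Lemma mulmx_conj_sum (Q X Y B C u v s t : 'M[R]_n.+4) (c : R) :
  X + Y = c *: (u + v) -> B + C = c *: (s + t) ->
  Q *m X *m Q + Q *m B *m Q + Q *m Y *m Q + Q *m C *m Q
  = c *: (Q *m (u + s + v + t) *m Q).
Proof.
move=> XY BC; rewrite -!mulmxDl -!mulmxDr scalemxAl scalemxAr.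
have -> : X + B + Y + C = X + Y + (B + C) by rewrite -addrA addrACA.
have -> : u + s + v + t = u + v + (s + t) by rewrite -addrA addrACA.
by rewrite XY BC -scalerDr.
Qed.

Lemma derive_mulmx_cst (A Q : 'M[R]_n.+4) (X : R * R -> 'M[R]_n.+4) z v :
  differentiable X z -> 'D_v (fun w => A *m X w *m Q) z = A *m 'D_v X z *m Q.
Proof.
move=> dX; have dA := differentiable_cst A z; have dQ := differentiable_cst Q z.
rewrite (derive_mulmx v (differentiable_mulmx dA dX) dQ) (derive_mulmx v dA dX).
by rewrite !derive_cst mul0mx mulmx0 add0r addr0.
Qed.

Variables (D U : set (R * R)) (h : R * R -> R * R) (A Q : 'M[R]_n.+4).
Hypotheses (oD : open D) (hol : holomorphic_on D h) (oU : open U)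
  (hU : forall z, D z -> U (h z)) (uA : A \in unitmx) (rQ : normal_reflection Q).
Variable F : R * R -> 'M[R]_n.+4.
Hypotheses (sF : smooth_on U F) (GF : forall z, U z -> G (F z)).

Local Notation p := (re_deriv h).
Local Notation q := (im_deriv h).
Local Notation F1 := (fun w => A *m F (h w) *m Q).

Let invF1 z : D z -> invmx (F1 z) = Q *m invmx (F (h z)) *m invmx A.
Proof.
move=> Dz; apply: invmx_eq.
have uF := Oplus_unit (SOplus_Oplus (GF (hU Dz))).
rewrite !mulmxA -(mulmxA _ (invmx A) A) mulVmx// mulmx1.
by rewrite -(mulmxA _ (invmx _) (F _)) mulVmx// mulmx1 reflectionK.
Qed.

Let dF z : U z -> differentiable F z.
Proof. by have [dF _ _] := sF 1%N; exact: dF. Qed.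

Let dFh z : D z -> differentiable (fun w => F (h w)) z.
Proof.
by move=> Dz; apply: (differentiable_comp (hol_differentiable hol Dz)); exact/dF/hU.
Qed.

Let translate_coef (z : R * R) (X : 'M[R]_n.+4) : D z ->
  invmx (F1 z) *m (A *m X *m Q) = Q *m (invmx (F (h z)) *m X) *m Q.
Proof.
by move=> Dz; rewrite invF1// !mulmxA -(mulmxA _ (invmx A) A) mulVmx// mulmx1.
Qed.

Lemma alphax_translate z : D z ->
  alphax F1 z = Q *m (p z *: alphax F (h z) + q z *: alphay F (h z)) *m Q.
Proof.
move=> Dz; rewrite /alphax /alphay.
have -> : dx F1 z = A *m (p z *: dx F (h z) + q z *: dy F (h z)) *m Q.
  rewrite -(dx_comp hol Dz (dF (hU Dz))); exact: derive_mulmx_cst (dFh Dz).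
by rewrite (translate_coef _ Dz) [in LHS]mulmx_comb.
Qed.

Lemma alphay_translate z : D z ->
  alphay F1 z = Q *m (- q z *: alphax F (h z) + p z *: alphay F (h z)) *m Q.
Proof.
move=> Dz; rewrite /alphax /alphay.
have -> : dy F1 z = A *m (- q z *: dx F (h z) + p z *: dy F (h z)) *m Q.
  rewrite -(dy_comp hol Dz (dF (hU Dz))); exact: derive_mulmx_cst (dFh Dz).
by rewrite (translate_coef _ Dz) [in LHS]mulmx_comb.
Qed.

Local Notation a := (fun w => ppart (alphax F w)).
Local Notation b := (fun w => ppart (alphay F w)).

Let differentiable_a z : U z -> differentiable a z.
Proof.
have [_ Fx _] := sF 2.
have [da _ _] := Ck_ppart oU (Ck_mulmx oU (Ck_invmx oU GF (sF 1)) Fx).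
exact: da.
Qed.

Let differentiable_b z : U z -> differentiable b z.
Proof.
have [_ _ Fy] := sF 2.
have [db _ _] := Ck_ppart oU (Ck_mulmx oU (Ck_invmx oU GF (sF 1)) Fy).
exact: db.
Qed.

(** The Maurer-Cartan form of A (F o h) Q is the pull-back by h of that of F,
    conjugated by Q.  The divergence part of the tension is covariant by
    [divergence_comp]; the bracket part because h' acts on (dx, dy) by a rotation times
    a scaling. *)
Lemma tension_translate z : D z ->
  tension F1 z = conformal_factor h z *: (Q *m tension F (h z) *m Q).
Proof.
move=> Dz; have QQ := reflectionK rQ.
have px w : D w ->
    ppart (alphax F1 w) = Q *m (p w *: a (h w) + q w *: b (h w)) *m Q.
  by move=> Dw; rewrite alphax_translate// ppart_conj// ppart_comb.
have py w : D w ->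
    ppart (alphay F1 w) = Q *m (- q w *: a (h w) + p w *: b (h w)) *m Q.
  by move=> Dw; rewrite alphay_translate// ppart_conj// ppart_comb.
have kx : kpart (alphax F1 z)
    = Q *m (p z *: kpart (alphax F (h z)) + q z *: kpart (alphay F (h z))) *m Q.
  by rewrite alphax_translate// kpart_conj// kpart_comb.
have ky : kpart (alphay F1 z)
    = Q *m (- q z *: kpart (alphax F (h z)) + p z *: kpart (alphay F (h z))) *m Q.
  by rewrite alphay_translate// kpart_conj// kpart_comb.
have dh := hol_differentiable hol Dz.
have dah := differentiable_comp dh (differentiable_a (hU Dz)).
have dbh := differentiable_comp dh (differentiable_b (hU Dz)).
have dp := differentiable_re_deriv oD hol Dz.
have dq := differentiable_im_deriv oD hol Dz.
have dx1 : dx (fun w => ppart (alphax F1 w)) z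
    = Q *m dx (fun w => p w *: a (h w) + q w *: b (h w)) z *m Q.
  rewrite (dx_congr oD Dz px); apply: derive_mulmx_cst.
  exact: differentiableD (differentiable_scalemx dp dah)
    (differentiable_scalemx dq dbh).
have dy1 : dy (fun w => ppart (alphay F1 w)) z
    = Q *m dy (fun w => - q w *: a (h w) + p w *: b (h w)) z *m Q.
  rewrite (dy_congr oD Dz py); apply: derive_mulmx_cst.
  exact: differentiableD (differentiable_scalemx (differentiableN dq) dah)
    (differentiable_scalemx dp dbh).
apply: etrans (congr2 +%R (congr2 +%R (congr2 +%R dx1
  (congr2 (@bracket R n) kx (px z Dz))) dy1) (congr2 (@bracket R n) ky (py z Dz))) _.
rewrite (bracket_conj _ _ QQ) (bracket_conj _ _ QQ).
apply: mulmx_conj_sum; last exact: bracket_rotate.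
have div := divergence_comp oD hol Dz
  (differentiable_a (hU Dz)) (differentiable_b (hU Dz)).
exact: div.
Qed.

End HarmonicTranslate.

(** * Symmetries of the Gauss map act on the induced surfaces *)

Section InducedSurfaces.
Context {R : realType}.
Variables (n : nat) (D : set (R * R)) (h g : R * R -> R * R) (A Q : 'M[R]_n.+4).
Hypotheses (oD : open D) (hol : holomorphic_on D h) (hD : forall z, D z -> D (h z))
  (dg : forall z, D z -> differentiable g z) (gK : forall z, D z -> g (h z) = z)
  (rQ : normal_reflection Q) (GAQ : G (A *m Q)).

Lemma Oplus_translation : @Oplus R n.+3 A.
Proof.
rewrite -[A]mulmx1 -(reflectionK rQ) mulmxA; apply: Oplus_mul.
  exact: SOplus_Oplus GAQ.
exact: reflection_Oplus.
Qed.

Lemma G_translate x : G x -> G (A *m x *m Q).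
Proof.
move=> Gx; have -> : A *m x *m Q = A *m Q *m (Q *m x *m Q).
  by rewrite !mulmxA -(mulmxA A Q Q) (reflectionK rQ) mulmx1.
by apply: SOplus_mul => //; exact: reflection_G.
Qed.

(** Stated for any f' with the right 4-spaces, since it is used for two of them: the
    given map f, for which this is its symmetry, and the harmonic map that witnesses
    the Willmore property. *)
Lemma conformal_gauss_map_transformed (y : R * R -> 'cV[R]_n.+3)
    (f f' : R * R -> set 'M[R]_n.+4) :
  conformal_immersion D y -> conformal_gauss_map D y f ->
  (forall z, D z -> GmodK (f' z) /\
     space_of (f' z) = [set A *m v | v in space_of (f (h z))]) ->
  conformal_gauss_map D (transformed_surface h A y) f'.
Proof.
move=> ysurf [Y Ylift Yspace] f'E; have OA := Oplus_translation.
exists (transformed_lift h A Y).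
  exact (canonical_transformed_lift oD hol hD dg gK OA ysurf Ylift).
move=> z Dz; have [Gf' ->] := f'E z Dz; split=> //.
rewrite (Yspace _ (hD Dz)).2.
by rewrite (gauss_space_transformed oD hol hD dg gK _ Ylift Dz).
Qed.

Definition translate_map (f : R * R -> set 'M[R]_n.+4) (z : R * R) :=
  [set A *m x *m Q | x in f (h z)].

Lemma harmonic_translate (f : R * R -> set 'M[R]_n.+4) :
  harmonic_on D f -> harmonic_on D (translate_map f).
Proof.
move=> fharm z Dz; have [U [F [oU Uz UD [sF FE] tens]]] := fharm _ (hD Dz).
have uA := Oplus_unit Oplus_translation.
pose U' := D `&` h @^-1` U.
have oU' : open U'.
  rewrite openE => w [Dw Uw]; apply: filterI.
    exact: (open_nbhs_nbhs (conj oD Dw)).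
  have hw := differentiable_continuous (hol_differentiable hol Dw).
  exact: (hw _ (open_nbhs_nbhs (conj oU Uw))).
have hU' w : U' w -> U (h w) by case.
have hol' : holomorphic_on U' h.
  by split=> [k|w [Dw _]]; [apply: Ck_sub (hol.1 k) => w []|exact: hol.2].
have GF w : U w -> G (F w) by move=> /FE[].
exists U', (fun w => A *m F (h w) *m Q); split => //.
- by move=> w [].
- split=> [k|w U'w].
    apply: (Ck_mulmx oU' _ (Ck_cst k U' Q)); apply: (Ck_mulmx oU' (Ck_cst k U' A)).
    exact: (Ck_mx_comp oU' oU hU' (hol'.1 k) (sF k)).
  split; first exact/G_translate/GF/hU'.
  by rewrite /translate_map (FE _ (hU' _ U'w)).2; exact: coset_translate.
- move=> w U'w.
  rewrite (tension_translate oU' hol' oU hU' uA rQ sF GF U'w) tens; last exact: hU'.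
  by rewrite mulmx0 mul0mx scaler0.
Qed.

(** The harmonic map attached to a Willmore surface may represent its 4-spaces with
    another orientation than f does, so it is transported by [translate_map] instead of
    by the symmetry of f. *)
Lemma willmore_transformed (y : R * R -> 'cV[R]_n.+3) :
  willmore D y -> willmore D (transformed_surface h A y).
Proof.
move=> [ysurf [f fgauss fharm]]; split.
  have [Y Ylift _] := fgauss.
  exact (transformed_immersion oD hol hD dg gK Oplus_translation ysurf Ylift).
exists (translate_map f); last exact: harmonic_translate.
apply: (conformal_gauss_map_transformed ysurf fgauss) => z Dz.
have [_ _ /(_ _ (hD Dz))[[x Gx fE] _]] := fgauss.
have E : translate_map f z = coset (A *m x *m Q).
  by rewrite /translate_map -fE; exact: coset_translate.
rewrite E -fE space_of_translate//; split=> //.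
by exists (A *m x *m Q) => //; exact: G_translate.
Qed.

(** The heart of the proof: at z the transformed surface has the 4-space A V, where V is
    the 4-space of f at h z; by the symmetry A V is the 4-space of f at z. *)
Lemma induces_transformed (f : R * R -> set 'M[R]_n.+4) (y : R * R -> 'cV[R]_n.+3) :
  (forall z, D z -> f z = act A (f (h z))) ->
  induces D f y -> induces D f (transformed_surface h A y).
Proof.
move=> fsym [ywill ygauss]; split; first exact: willmore_transformed.
apply: (conformal_gauss_map_transformed ywill.1 ygauss) => z Dz.
have [Y _ gaussE] := ygauss; split; first by have [] := gaussE z Dz.
have [[x _ fE] _] := gaussE _ (hD Dz); rewrite (fsym z Dz) -fE.
exact: space_of_act.
Qed.

End InducedSurfaces.

Unset Implicit Arguments.

Theorem theorem4p11 (R : realType) (n : nat) (hn : (1 <= n)%N)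
  (D : set (R * R)) (hDopen : open D) (hD0 : D 0) (hDc : contractible D)
  (f : R * R -> set 'M[R]_n.+4)
  (hharm : harmonic_on D f) (hconf : conformal_on D f)
  (F : R * R -> 'M[R]_n.+4) (hF : lift_on D f F)
  (Fl : R * R -> R * R -> 'M[R]_n.+4) (hFl : extended_frame D F Fl)
  (gam : R * R -> R * R) (hgam : conformal_automorphism D gam)
  (chi : R * R -> 'M[R]_n.+4) (hchi : monodromy_loop chi)
  (hsym : forall lam z, circle lam -> D z ->
     coset (Fl (gam z) lam) = act (chi lam) (coset (Fl z lam))) :
  forall lam : R * R, circle lam ->
  let flam := fun z => coset (Fl z lam) in
  (forall (y : R * R -> 'cV[R]_n.+3) (Y : R * R -> 'cV[R]_n.+4),
     induces_unique D flam y -> canonical_lift D y Y ->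
     forall z, D z ->
       y (gam z) = sphere_point (Y (gam z)) /\
       sphere_point (Y (gam z)) = sphere_point (chi lam *m Y z)) /\
  (forall (y yh : R * R -> 'cV[R]_n.+3) (Y Yh : R * R -> 'cV[R]_n.+4),
     induces_dual_pair D flam y yh ->
     canonical_lift D y Y -> canonical_lift D yh Yh ->
     (forall z, D z ->
       y (gam z) = sphere_point (Y (gam z)) /\
       sphere_point (Y (gam z)) = sphere_point (chi lam *m Y z)) \/
     (forall z, D z ->
       yh (gam z) = sphere_point (Yh (gam z)) /\
       sphere_point (Yh (gam z)) = sphere_point (chi lam *m Y z))).
Proof.
move=> lam Clam flam.
have [h [gamhol hhol gamD hgD]] := hgam.
have [Q rQ GQ] := monodromy_reflection Clam hchi.
have hD z : D z -> D (h z) by case/hgD.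
have hK z : D z -> gam (h z) = z by case/hgD.
have dgam z : D z -> differentiable gam z.
  exact (fun Dz => hol_differentiable gamhol Dz).
pose y1 y := transformed_surface h (chi lam) y.
have y1_induced y : induces D flam y -> induces D flam (y1 y).
  apply: (induces_transformed hDopen hhol hD dgam hK rQ GQ) => z Dz.
  by rewrite -(hsym _ _ Clam (hD z Dz)) /flam hK.
(* Any lift will do, since positive factors disappear in the projection. *)
have y1_gam y Y : canonical_lift D y Y -> forall z, D z ->
    y1 y (gam z) = sphere_point (chi lam *m Y z).
  move=> Ylift z Dz; have [cone yE _] := Ylift.2 z Dz.
  rewrite /y1 /transformed_surface (gamD z Dz).2 -yE.
  by rewrite -sphere_point_mul//; exact: forward_cone_neq0.
have liftE (y : R * R -> 'cV[R]_n.+3) (Y : R * R -> 'cV[R]_n.+4) :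
    canonical_lift D y Y -> forall z, D z ->
    sphere_point (Y (gam z)) = y (gam z).
  by move=> Ylift z Dz; have [] := Ylift.2 _ (gamD z Dz).1.
split=> [y Y [yind yuniq] Ylift z Dz|y yh Y Yh [yind yhind _ ypair] Ylift Yhlift].
  rewrite (liftE y Y)//; split=> //; rewrite -(y1_gam y Y)//.
  exact: esym (yuniq _ (y1_induced y yind) _ (gamD z Dz).1).
have [y1E|y1E] := ypair _ (y1_induced y yind); [left|right] => z Dz.
- rewrite (liftE y Y)//; split=> //; rewrite -(y1_gam y Y)//.
  exact: esym (y1E _ (gamD z Dz).1).
- rewrite (liftE yh Yh)//; split=> //; rewrite -(y1_gam y Y)//.
  exact: esym (y1E _ (gamD z Dz).1).
Qed.
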